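(* Let $\mathcal U$ be a universal class of Heyting algebras, and let $\sigma(\mathcal U)$ be the universal class of Grzegorczyk algebras generated by the free Boolean extensions $\mathsf B(\mathbf H)$ of the algebras $\mathbf H\in\mathcal U$. Then (1) $\mathcal U$ is strongly structurally complete if and only if $\sigma(\mathcal U)$ is strongly structurally complete; (2) $\mathcal U$ is strongly universally complete if and only if $\sigma(\mathcal U)$ is strongly universally complete.
   Context: A modal algebra is a Boolean algebra with a unary operation $\Box$ such that $\Box(a\wedge b)=\Box a\wedge\Box b$ and $\Box 1=1$. An interior algebra is a modal algebra satisfying $\Box\Box a=\Box a\leqslant a$ for all $a$. A Grzegorczyk algebra is an interior algebra satisfying $\Box(\Box(a\to\Box a)\to a)\leqslant a$ for all $a$ (here $x\to y=\neg x\vee y$). An element $a$ is open if $\Box a=a$. For an interior algebra $\mathbf M$, its open elements form a Heyting algebra $\mathsf O(\mathbf M)$ with the order inherited from $\mathbf M$. Free Boolean extension: for every Heyting algebra $\mathbf H$ there is (McKinsey–Tarski) an interior algebra $\mathsf B(\mathbf H)$, unique up to isomorphism over $\mathbf H$, such that $\mathsf O(\mathsf B(\mathbf H))=\mathbf H$; whenever $\mathbf M$ is an interior algebra with $\mathbf H$ a subalgebra of $\mathsf O(\mathbf M)$, $\mathsf B(\mathbf H)$ is isomorphic to the subalgebra of $\mathbf M$ generated by $H$; and every homomorphism $\mathbf H\to\mathsf O(\mathbf M)$, with $\mathbf M$ an interior algebra, extends uniquely to a homomorphism $\mathsf B(\mathbf H)\to\mathbf M$. Every $\mathsf B(\mathbf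 H)$ is a Grzegorczyk algebra. A disjunctive universal sentence is a first-order sentence of the form $$(\forall\bar x)\,[\,s_1\approx s_1'\text{ and }\cdots\text{ and }s_m\approx s_m'\ \Rightarrow\ t_1\approx t_1'\text{ or }\cdots\text{ or }t_n\approx t_n'\,]$$ with $s_i,s_i',t_j,t_j'$ terms and $m,n\geq 0$ not both zero. It is a quasi-identity if $n=1$, and an identity if $m=0$ and $n=1$. A universal class is a class of algebras (of a fixed signature) axiomatized by disjunctive universal sentences. The least universal class containing a class $\mathcal K$ is $\mathsf{SP_U}(\mathcal K)$ (subalgebras of ultraproducts, up to isomorphism). Thus $\sigma(\mathcal U)=\mathsf{SP_U}(\{\mathsf B(\mathbf H)\mid\mathbf H\in\mathcal U\})$. A disjunctive universal sentence $v$ is weakly admissible for a universal class $\mathcal U$ if the set of identities satisfied in $\mathcal U$ coincides with the set of identities satisfied in the class of all algebras from $\mathcal U$ that satisfy $v$. A universal class $\mathcal U$ is strongly structurally complete if the set of quasi-identities weakly admissible for $\mathcal U$ coincides with the set of quasi-identities that hold in $\mathcal U$. It is strongly universally complete if the set of disjunctive universal sentences weakly admissible for $\mathcal U$ coincides with the set of disjunctive universal sentences that hold in $\mathcal U$. *)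

(* Defs.v *)
From mathcomp Require Import all_boot.
From Stdlib Require List.
From Stdlib Require Import ProofIrrelevance.

Set Implicit Arguments.
Unset Strict Implicit.
Unset Printing Implicit Defensive.

(** * Algebras of a finitary signature *)

Record signature := Signature { op : Type; arity : op -> nat }.

Record algebra (S : signature) := Algebra {
  carrier :> Type;
  interp : forall o : op S, ('I_(arity o) -> carrier) -> carrier }.

Definition is_hom (S : signature) (A B : algebra S) (f : A -> B) : Prop :=
  forall (o : op S) (x : 'I_(arity o) -> A),
    f (interp x) = interp (fun k => f (x k)).

Definition is_iso (S : signature) (A B : algebra S) (f : A -> B) : Prop :=
  is_hom f /\ bijective f.

Definition subuniverse (S : signature) (A : algebra S) (P : A -> Prop) : Prop :=
  forall (o : op S) (x : 'I_(arity o) -> A),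
    (forall k, P (x k)) -> P (interp x).

Definition generated_subuniverse (S : signature) (A : algebra S) (X : A -> Prop)
    (a : A) : Prop :=
  forall P : A -> Prop, subuniverse P -> (forall x, X x -> P x) -> P a.

(** * Disjunctive universal sentences *)

Inductive term (S : signature) : Type :=
| Var of nat
| App (o : op S) of ('I_(arity o) -> term S).

Fixpoint eval (S : signature) (A : algebra S) (env : nat -> A) (t : term S) : A :=
  match t with
  | Var n => env n
  | App o ts => interp (fun k => eval env (ts k))
  end.

Definition equation (S : signature) : Type := (term S * term S)%type.

Definition eq_holds (S : signature) (A : algebra S) (env : nat -> A)
    (e : equation S) : Prop := eval env e.1 = eval env e.2.

(* The universal closure of: all [premises] imply some of the [conclusions]. *)
Record du_sentence (S : signature) := DUSentence {
  premises : seq (equation S);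
  conclusions : seq (equation S);
  du_nonempty : ~ (size premises = 0 /\ size conclusions = 0) }.

Definition is_quasi_identity (S : signature) (v : du_sentence S) : Prop :=
  size (conclusions v) = 1.

Definition is_identity (S : signature) (v : du_sentence S) : Prop :=
  size (premises v) = 0 /\ size (conclusions v) = 1.

Definition satisfies (S : signature) (A : algebra S) (v : du_sentence S) : Prop :=
  forall env : nat -> A,
    List.Forall (eq_holds env) (premises v) ->
    List.Exists (eq_holds env) (conclusions v).

(** * Universal classes and completeness *)

Definition holds_in (S : signature) (K : algebra S -> Prop) (v : du_sentence S)
  : Prop := forall A, K A -> satisfies A v.

Definition universal_class (S : signature) (K : algebra S -> Prop) : Prop :=
  exists Sigma : du_sentence S -> Prop,
    forall A, K A <-> (forall v, Sigma v -> satisfies A v).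

Definition weakly_admissible (S : signature) (K : algebra S -> Prop)
    (v : du_sentence S) : Prop :=
  forall e : du_sentence S, is_identity e ->
    (holds_in K e <-> holds_in (fun A => K A /\ satisfies A v) e).

Definition strongly_structurally_complete (S : signature)
    (K : algebra S -> Prop) : Prop :=
  forall q : du_sentence S, is_quasi_identity q ->
    (weakly_admissible K q <-> holds_in K q).

Definition strongly_universally_complete (S : signature)
    (K : algebra S -> Prop) : Prop :=
  forall v : du_sentence S, weakly_admissible K v <-> holds_in K v.

(** * Heyting algebras *)

Definition args0 (T : Type) : 'I_0 -> T :=
  fun k => False_rect T (notF (ltn_ord k)).
Definition args1 (T : Type) (a : T) : 'I_1 -> T := fun=> a.
Definition args2 (T : Type) (a b : T) : 'I_2 -> T :=
  fun k => if val k is 0 then a else b.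

Record is_bounded_lattice (T : Type) (meet join : T -> T -> T) (bot top : T)
  : Prop := {
  bl_meetC : commutative meet;
  bl_joinC : commutative join;
  bl_meetA : associative meet;
  bl_joinA : associative join;
  bl_meetK : forall a b, meet a (join a b) = a;
  bl_joinK : forall a b, join a (meet a b) = a;
  bl_meet1 : right_id top meet;
  bl_join0 : right_id bot join }.

Inductive heyting_op := HMeet | HJoin | HImp | HBot | HTop.

Definition heyting_arity (o : heyting_op) : nat :=
  match o with HMeet | HJoin | HImp => 2 | HBot | HTop => 0 end.

Definition heyting_sig : signature := Signature heyting_arity.

Section HeytingOperations.
Variable A : algebra heyting_sig.
Definition hmeet (a b : A) : A := @interp _ A HMeet (args2 a b).
Definition hjoin (a b : A) : A := @interp _ A HJoin (args2 a b).
Definition himp (a b : A) : A := @interp _ A HImp (args2 a b).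
Definition hbot : A := @interp _ A HBot (@args0 A).
Definition htop : A := @interp _ A HTop (@args0 A).
Definition hle (a b : A) : Prop := hmeet a b = a.

Definition is_heyting_algebra : Prop :=
  is_bounded_lattice hmeet hjoin hbot htop /\
  (forall a b c, hle c (himp a b) <-> hle (hmeet c a) b).
End HeytingOperations.

(** * Modal, interior and Grzegorczyk algebras *)

Inductive modal_op := MMeet | MJoin | MNeg | MBox | MBot | MTop.

Definition modal_arity (o : modal_op) : nat :=
  match o with MMeet | MJoin => 2 | MNeg | MBox => 1 | MBot | MTop => 0 end.

Definition modal_sig : signature := Signature modal_arity.

Section ModalOperations.
Variable M : algebra modal_sig.
Definition mmeet (a b : M) : M := @interp _ M MMeet (args2 a b).
Definition mjoin (a b : M) : M := @interp _ M MJoin (args2 a b).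
Definition mneg (a : M) : M := @interp _ M MNeg (args1 a).
Definition mbox (a : M) : M := @interp _ M MBox (args1 a).
Definition mbot : M := @interp _ M MBot (@args0 M).
Definition mtop : M := @interp _ M MTop (@args0 M).
Definition mimp (a b : M) : M := mjoin (mneg a) b.
Definition mle (a b : M) : Prop := mmeet a b = a.

Record is_boolean_algebra : Prop := {
  ba_lattice : is_bounded_lattice mmeet mjoin mbot mtop;
  ba_distr : left_distributive mmeet mjoin;
  ba_meetN : forall a, mmeet a (mneg a) = mbot;
  ba_joinN : forall a, mjoin a (mneg a) = mtop }.

Record is_modal_algebra : Prop := {
  ma_boolean : is_boolean_algebra;
  ma_boxI : forall a b, mbox (mmeet a b) = mmeet (mbox a) (mbox b);
  ma_box1 : mbox mtop = mtop }.

Record is_interior_algebra : Prop := {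
  ia_modal : is_modal_algebra;
  ia_box_box : forall a, mbox (mbox a) = mbox a;
  ia_box_le : forall a, mle (mbox a) a }.

Definition is_grzegorczyk_algebra : Prop :=
  is_interior_algebra /\
  (forall a, mle (mbox (mimp (mbox (mimp a (mbox a))) a)) a).

Definition is_open (a : M) : Prop := mbox a = a.
End ModalOperations.

(** * The Heyting algebra of open elements *)

Section OpenElements.
Variables (M : algebra modal_sig) (hM : is_interior_algebra M).

Let L := ba_lattice (ma_boolean (ia_modal hM)).

Lemma mle_refl (a : M) : mle a a.
Proof. by rewrite /mle -{2}(bl_joinK L a a) (bl_meetK L). Qed.

Lemma mle_trans (b a c : M) : mle a b -> mle b c -> mle a c.
Proof. by rewrite /mle => <- bc; rewrite -(bl_meetA L) bc. Qed.

Lemma mle_anti (a b : M) : mle a b -> mle b a -> a = b.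
Proof. by move=> ab ba; rewrite -ab (bl_meetC L). Qed.

Lemma mle_joinl (a b : M) : mle a (mjoin a b).
Proof. exact: (bl_meetK L). Qed.

Lemma mle_joinr (a b : M) : mle b (mjoin a b).
Proof. by rewrite (bl_joinC L); exact: mle_joinl. Qed.

Lemma mle_joinE (a b : M) : mle a b <-> mjoin a b = b.
Proof.
split=> [ab|<-]; last exact: mle_joinl.
by rewrite -ab (bl_joinC L) (bl_meetC L) (bl_joinK L).
Qed.

Lemma mle_join (a b c : M) : mle a c -> mle b c -> mle (mjoin a b) c.
Proof. by move=> /mle_joinE ac /mle_joinE bc; apply/mle_joinE; rewrite -(bl_joinA L) bc. Qed.

Lemma mbox_mono (a b : M) : mle a b -> mle (mbox a) (mbox b).
Proof. by rewrite /mle -(ma_boxI (ia_modal hM)) => ->. Qed.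

Lemma open_meet (a b : M) : is_open a -> is_open b -> is_open (mmeet a b).
Proof. by rewrite /is_open (ma_boxI (ia_modal hM)) => -> ->. Qed.

Lemma open_join (a b : M) : is_open a -> is_open b -> is_open (mjoin a b).
Proof.
move=> oa ob; apply: mle_anti; first exact: (ia_box_le hM).
apply: mle_join.
- by rewrite -{1}oa; apply: mbox_mono; exact: mle_joinl.
- by rewrite -{1}ob; apply: mbox_mono; exact: mle_joinr.
Qed.

Lemma open_box (a : M) : is_open (mbox a).
Proof. exact: (ia_box_box hM). Qed.

Lemma open_bot : is_open (mbot M).
Proof.
apply: mle_anti; first exact: (ia_box_le hM).
by apply/mle_joinE; rewrite (bl_joinC L) (bl_join0 L).
Qed.

Lemma open_top : is_open (mtop M).
Proof. exact: (ma_box1 (ia_modal hM)). Qed.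

Definition open_elt : Type := {a : M | is_open a}.

Definition open_interp (o : heyting_op) :
    ('I_(heyting_arity o) -> open_elt) -> open_elt :=
  match o return ('I_(heyting_arity o) -> open_elt) -> open_elt with
  | HMeet => fun x =>
      exist _ _ (open_meet (proj2_sig (x ord0)) (proj2_sig (x ord_max)))
  | HJoin => fun x =>
      exist _ _ (open_join (proj2_sig (x ord0)) (proj2_sig (x ord_max)))
  | HImp => fun x =>
      exist _ _ (open_box (mimp (proj1_sig (x ord0)) (proj1_sig (x ord_max))))
  | HBot => fun=> exist _ _ open_bot
  | HTop => fun=> exist _ _ open_top
  end.

Definition opens : algebra heyting_sig := @Algebra heyting_sig open_elt open_interp.

Lemma open_elt_inj (a b : open_elt) : proj1_sig a = proj1_sig b -> a = b.
Proof.
case: a b => [a oa] [b ob] /= ab; subst b.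
by rewrite (proof_irrelevance _ oa ob).
Qed.

(* The order of [opens] is the one inherited from [M] and, by [opens_heyting],
   it determines all the operations. *)
Lemma opens_le (a b : opens) : hle a b <-> mle (proj1_sig a) (proj1_sig b).
Proof. by split=> [/(congr1 (@proj1_sig _ _))|ab]; last exact: open_elt_inj. Qed.

Lemma mimp_residual (a b c : M) : mle c (mimp a b) <-> mle (mmeet c a) b.
Proof.
have B := ma_boolean (ia_modal hM).
have distr (x y z : M) : mmeet x (mjoin y z) = mjoin (mmeet x y) (mmeet x z).
  by rewrite !(bl_meetC L x) (ba_distr B).
have meetlS (x y z : M) : mle x y -> mle (mmeet x z) (mmeet y z).
  rewrite /mle => xy.
  rewrite -(bl_meetA L) (bl_meetC L y) (bl_meetA L z) mle_refl.
  by rewrite (bl_meetC L z) (bl_meetA L) xy.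
have lel (x y : M) : mle (mmeet x y) x.
  by rewrite /mle (bl_meetC L x) -(bl_meetA L) mle_refl.
split=> [cab|cab].
  apply: (mle_trans (meetlS _ _ a cab)).
  rewrite /mimp (ba_distr B) (bl_meetC L (mneg a)) (ba_meetN B).
  by rewrite (bl_joinC L) (bl_join0 L); exact: lel.
rewrite -(bl_meet1 L c) -(ba_joinN B a) distr; apply: mle_join.
  exact: (mle_trans cab (mle_joinr _ _)).
by rewrite (bl_meetC L); apply: (mle_trans (lel _ _) (mle_joinl _ _)).
Qed.

Lemma opens_heyting : is_heyting_algebra opens.
Proof.
split.
  split.
  - by move=> a b; apply: open_elt_inj; exact: (bl_meetC L).
  - by move=> a b; apply: open_elt_inj; exact: (bl_joinC L).
  - by move=> a b c; apply: open_elt_inj; exact: (bl_meetA L).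
  - by move=> a b c; apply: open_elt_inj; exact: (bl_joinA L).
  - by move=> a b; apply: open_elt_inj; exact: (bl_meetK L).
  - by move=> a b; apply: open_elt_inj; exact: (bl_joinK L).
  - by move=> a; apply: open_elt_inj; exact: (bl_meet1 L).
  - by move=> a; apply: open_elt_inj; exact: (bl_join0 L).
move=> a b c.
apply: (iff_trans (opens_le c (himp a b))).
apply: (iff_trans _ (iff_sym (opens_le (hmeet c a) b))).
apply: (iff_trans _ (mimp_residual (proj1_sig a) (proj1_sig b) (proj1_sig c))).
split=> cab; first exact: (mle_trans cab (ia_box_le hM _)).
by rewrite -(proj2_sig c); exact: mbox_mono.
Qed.
End OpenElements.

(** * Free Boolean extensions *)

(* [M], together with the identification [i] of [H] with the Heyting algebra of
   its open elements, is the free Boolean extension B(H). *)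
Record is_free_boolean_extension (H : algebra heyting_sig)
    (M : algebra modal_sig) (hM : is_interior_algebra M)
    (i : H -> opens hM) : Prop := {
  fbe_iso : is_iso i;
  fbe_generated :
    forall (N : algebra modal_sig) (hN : is_interior_algebra N)
      (j : H -> opens hN), is_hom j -> injective j ->
    exists k : M -> N,
      [/\ is_hom k, injective k,
          forall h, k (proj1_sig (i h)) = proj1_sig (j h) &
          forall y, (exists x, k x = y) <->
            generated_subuniverse (fun z => exists h, z = proj1_sig (j h)) y];
  fbe_extension :
    forall (N : algebra modal_sig) (hN : is_interior_algebra N)
      (f : H -> opens hN), is_hom f ->
    exists! g : M -> N,
      is_hom g /\ forall h, g (proj1_sig (i h)) = proj1_sig (f h) }.

Definition free_boolean_extension (H : algebra heyting_sig)
    (M : algebra modal_sig) : Prop :=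
  exists (hM : is_interior_algebra M) (i : H -> opens hM),
    is_free_boolean_extension i.

(* The least universal class of Grzegorczyk algebras that contains B(H) for
   every H in [U]. *)
Definition sigma (U : algebra heyting_sig -> Prop) (A : algebra modal_sig)
  : Prop :=
  forall C : algebra modal_sig -> Prop,
    universal_class C ->
    (forall M, C M -> is_grzegorczyk_algebra M) ->
    (forall H M, U H -> free_boolean_extension H M -> C M) ->
    C A.

Lemma sigma_universal (U : algebra heyting_sig -> Prop) :
  universal_class (sigma U).
Proof.
pose good (C : algebra modal_sig -> Prop) :=
  [/\ universal_class C, forall M, C M -> is_grzegorczyk_algebra M &
      forall H M, U H -> free_boolean_extension H M -> C M].
exists (fun v => exists2 C, good C & holds_in C v) => A; split.
  by move=> sA v [C [uC gC bC]]; apply; exact: sA.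
move=> sA C uC gC bC; have [Sg defC] := uC; apply/defC => v Sv; apply: sA.
by exists C => // B /defC; exact.
Qed.

(* Main.v *)
(* Key fact: a disjunctive universal sentence v holds in a Grzegorczyk algebra M
   as soon as it holds in the subalgebra B generated by the open elements of M.
   For d in M put kernel d = d /\ [](d \/ []~d).  This element equals
   [](d \/ []~d) /\ ~[]~d, hence is in B, and the Grzegorczyk axiom gives
   []~(kernel d) = []~d.  Let d range over the atoms of the Boolean algebra
   generated by finitely many elements of M.  A partition of unity in B which
   extends the kernels, and which leaves the boxed elements fixed, carries a copy
   of these elements.  Dually, such a partition is a map on ultrafilters that
   fixes those containing a kernel and sends the others to finitely many chosen
   ones.

   Elements of B are conjunctions of terms ~u \/ w with u, w open, so v is
   equivalent in M to a family of Heyting sentences, of the same shape as v, on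
   the open elements.  Together with the Goedel translation in the other
   direction this matches the weakly admissible sentences of U with those of
   sigma U, which consists of the Grzegorczyk algebras whose Heyting algebra of
   open elements is in U. *)

From mathcomp Require Import all_boot boolp classical_sets.
Require Import Defs.

Set Implicit Arguments.
Unset Strict Implicit.
Unset Printing Implicit Defensive.

(** * Prime filters *)

Section PrimeFilters.
Variables (T : Type) (meet join : T -> T -> T) (bot top : T).

(** The equivalence includes upward closure, since [a] is below [b] exactly when [meet a b = a]. *)
Record is_filter (F : T -> Prop) : Prop := {
  filter_top : F top;
  filter_meet : forall a b, F (meet a b) <-> F a /\ F b }.

Record is_prime (p : T -> Prop) : Prop := {
  prime_filter : is_filter p;
  prime_bot : ~ p bot;
  prime_join : forall a b, p (join a b) <-> p a \/ p b }.

Hypothesis L : is_bounded_lattice meet join bot top.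
Hypothesis D : left_distributive meet join.

(** Zorn's lemma gives a filter maximal among those that contain [F] and omit [b]; distributivity
    makes it prime. *)
Lemma prime_filter_exists (F : T -> Prop) (b : T) :
  is_filter F -> ~ F b ->
  exists2 p, is_prime p & (forall a, F a -> p a) /\ ~ p b.
Proof.
move=> filF Fb.
have meet_idem a : meet a a = a by rewrite -{2}(bl_joinK L a a) (bl_meetK L).
have meetlel x y : meet (meet x y) x = meet x y.
  by rewrite (bl_meetC L x) -(bl_meetA L) meet_idem.
pose good (G : T -> Prop) := [/\ is_filter G, forall a, F a -> G a & ~ G b].
(* [set0] is only there to be the union of the empty chain. *)
have [p [goodp maxp]] :
    exists A, (A = set0 \/ good A) /\
      forall B, (A `<` B)%classic -> ~ (B = set0 \/ good B).
  apply: Zorn_bigcup => C Cgood Ctot.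
  case: (EM (exists2 X, C X & good X)) => [[X CX [filX FX Xb]]|noX]; last first.
    left; apply/seteqP; split=> // x [X CX Xx].
    have [X0|gX] := Cgood _ CX; first by move: Xx; rewrite X0.
    by case: noX; exists X.
  have Cfil Y y : C Y -> Y y -> good Y.
    by move=> CY Yy; case: (Cgood _ CY) => // Y0; move: Yy; rewrite Y0.
  right; split=> [||[Y CY Yb]].
  - split; first by exists X => //; exact: filter_top.
    move=> x y; split.
      move=> [Y CY Yxy]; have [filY _ _] := Cfil _ _ CY Yxy.
      by have [Yx Yy] := (filter_meet filY x y).1 Yxy; split; exists Y.
    move=> [[Y CY Yx] [Z CZ Zy]].
    have [filY _ _] := Cfil _ _ CY Yx; have [filZ _ _] := Cfil _ _ CZ Zy.
    case: (Ctot _ _ CY CZ) => YZ.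
      by exists Z => //; apply/(filter_meet filZ); split=> //; exact: YZ.
    by exists Y => //; apply/(filter_meet filY); split=> //; exact: YZ.
  - by move=> a Fa; exists X => //; exact: FX.
  - by case: (Cfil _ _ CY Yb).
have {goodp} [filp Fp pb] : good p.
  (* The empty set is not maximal, because [F] itself is a larger admissible set. *)
  case: goodp => // p0; case: (maxp F); last by right; split.
  rewrite p0 /proper; split=> // F0; exact: (F0 _ (filter_top filF)).
(* By maximality, the filter generated by [p] and an element outside [p] must contain [b]. *)
have adjoin x : ~ p x -> exists2 w, p w & meet (meet w x) b = meet w x.
  move=> px; apply: contrapT => now.
  pose G z := exists2 w, p w & meet (meet w x) z = meet w x.
  have pG a : p a -> G a.
    move=> pa; exists a => //; exact: meetlel.
  apply: (maxp G); first split=> // Gp.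
    apply/px/Gp; exists top; first exact: filter_top.
    by rewrite -(bl_meetA L) meet_idem.
  right; split=> [||[w pw wb]]; last by apply: now; exists w.
  - split; first by apply: pG; exact: filter_top.
    move=> y z; split.
      move=> [w pw]; rewrite (bl_meetA L) => e; split; exists w => //.
        by rewrite -{1}e -(bl_meetA L _ z) (bl_meetC L z) (bl_meetA L)
          -(bl_meetA L _ y y) meet_idem e.
      by rewrite -e -(bl_meetA L) meet_idem.
    move=> [[w pw wy] [w' pw' wz]]; exists (meet w w').
      by apply/(filter_meet filp).
    have e1 : meet (meet w w') x = meet w' (meet w x).
      by rewrite (bl_meetA L) (bl_meetC L w').
    have e2 : meet (meet w w') x = meet w (meet w' x) by rewrite (bl_meetA L).
    by rewrite (bl_meetA L) {1}e1 -(bl_meetA L w') wy -e1 e2 -(bl_meetA L w) wz.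
  - by move=> a Fa; apply/pG/Fp.
exists p => //; split=> // [pbot|x y].
  apply: pb; have e : meet bot b = bot.
    by rewrite -[LHS](bl_join0 L) (bl_joinC L) (bl_joinK L).
  by move: pbot; rewrite -e => /(filter_meet filp) [].
split=> [pxy|].
  (* Otherwise one element of [p] meets both [x] and [y] below [b], hence also their join, which
     forces [b] into [p]. *)
  apply: contrapT => npxy.
  have [w pw wx] := adjoin x (fun px => npxy (or_introl px)).
  have [w' pw' wy] := adjoin y (fun py => npxy (or_intror py)).
  have : p (meet (meet w w') (join x y)).
    by apply/(filter_meet filp); split=> //; apply/(filter_meet filp).
  have e : meet (meet (meet w w') (join x y)) b = meet (meet w w') (join x y).
    rewrite (bl_meetC L _ (join x y)) !D.
    congr (join _ _).
      by rewrite (bl_meetC L w) (bl_meetC L x) -!(bl_meetA L) (bl_meetA L w) wx.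
    by rewrite (bl_meetC L y) -!(bl_meetA L) (bl_meetA L w') wy.
  by rewrite -e => /(filter_meet filp) [].
case=> [px|py].
  by move: px; rewrite -{1}(bl_meetK L x y) => /(filter_meet filp) [].
move: py; rewrite -{1}(bl_meetK L y x) (bl_joinC L) => /(filter_meet filp) [].
by [].
Qed.

Lemma principal_filter (a : T) : is_filter (fun x => meet a x = a).
Proof.
have meet_idem x : meet x x = x by rewrite -{2}(bl_joinK L x x) (bl_meetK L).
split=> [|x y]; first exact: bl_meet1 L a.
split=> [e|[ex ey]]; last by rewrite (bl_meetA L) ex.
split; last by rewrite -{1}e -!(bl_meetA L) meet_idem.
rewrite (bl_meetA L) in e.
by rewrite -{1}e -(bl_meetA L _ y) (bl_meetC L y) (bl_meetA L) -(bl_meetA L _ x x)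
  meet_idem e.
Qed.

Lemma prime_separation (a b : T) : meet a b <> a ->
  exists2 p, is_prime p & p a /\ ~ p b.
Proof.
move=> ab; have [p pp [ap npb]] := prime_filter_exists (principal_filter a) ab.
exists p => //; split=> //; apply: ap.
by rewrite -{2}(bl_joinK L a a) (bl_meetK L).
Qed.

(** Separation in both directions; identities are reduced through it to statements about a single
    prime filter. *)
Lemma prime_ext (a b : T) :
  (forall p, is_prime p -> p a <-> p b) -> a = b.
Proof.
move=> ab; have le x y : (forall p, is_prime p -> p x -> p y) -> meet x y = x.
  by move=> xy; apply: contrapT => /prime_separation [p pp [px]]; apply; exact: xy.
have ab1 := le a b (fun p pp => (ab p pp).1).
by rewrite -ab1 (bl_meetC L) (le b a (fun p pp => (ab p pp).2)).
Qed.
End PrimeFilters.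

(** * Terms and homomorphisms *)

Section Homomorphisms.
Variable S : signature.

(** Evaluation of terms becomes a homomorphism, and syntactic translations become evaluations in
    algebras built from terms. *)
Definition term_algebra : algebra S := @Algebra S (term S) (@App S).

Lemma eval_is_hom (A : algebra S) (env : nat -> A) :
  is_hom (eval env : term_algebra -> A).
Proof. by []. Qed.

Lemma eval_hom (A B : algebra S) (f : A -> B) (env : nat -> A) (t : term S) :
  is_hom f -> f (eval env t) = eval (fun n => f (env n)) t.
Proof.
move=> hf; elim: t => //= o ts IH; rewrite hf.
by congr (interp _); apply: funext => k; exact: IH.
Qed.

Lemma image_subuniverse (A B : algebra S) (f : A -> B) :
  is_hom f -> subuniverse (fun y => exists x, f x = y).
Proof.
move=> hf o x /choice [g gx]; exists (interp g); rewrite hf.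
by congr (interp _); apply: funext => k.
Qed.
End Homomorphisms.

Lemma args0_comp (T T' : Type) (f : T -> T') :
  (fun k => f (args0 T k)) = args0 T'.
Proof. by apply: funext => -[]. Qed.

Lemma args2_comp (T T' : Type) (f : T -> T') (a b : T) :
  (fun k => f (args2 a b k)) = args2 (f a) (f b).
Proof. by apply: funext => -[[|k] hk]. Qed.

Lemma args0_eta (T : Type) (x : 'I_0 -> T) : x = args0 T.
Proof. by apply: funext => -[]. Qed.

Lemma args1_eta (T : Type) (x : 'I_1 -> T) : x = args1 (x ord0).
Proof. by apply: funext => k; rewrite (ord1 k). Qed.

Lemma args2_eta (T : Type) (x : 'I_2 -> T) : x = args2 (x ord0) (x ord_max).
Proof.
apply: funext => -[[|[|k]] hk] //; rewrite /args2 /=; congr (x _); exact: val_inj.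
Qed.

Section HeytingHom.
Variables (A B : algebra heyting_sig) (f : A -> B).

Lemma heyting_homP :
  (forall a b, f (hmeet a b) = hmeet (f a) (f b)) ->
  (forall a b, f (hjoin a b) = hjoin (f a) (f b)) ->
  (forall a b, f (himp a b) = himp (f a) (f b)) ->
  f (hbot A) = hbot B -> f (htop A) = htop B -> is_hom f.
Proof.
move=> fM fJ fI f0 f1 [] /= x.
- rewrite [x]args2_eta; apply: etrans (fM _ _) _.
  by rewrite /hmeet -args2_comp.
- rewrite [x]args2_eta; apply: etrans (fJ _ _) _.
  by rewrite /hjoin -args2_comp.
- rewrite [x]args2_eta; apply: etrans (fI _ _) _.
  by rewrite /himp -args2_comp.
- by rewrite [x]args0_eta; apply: etrans f0 _; rewrite args0_comp.
- by rewrite [x]args0_eta; apply: etrans f1 _; rewrite args0_comp.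
Qed.

Hypothesis hf : is_hom f.

Lemma hom_hmeet a b : f (hmeet a b) = hmeet (f a) (f b).
Proof. by rewrite /hmeet hf args2_comp. Qed.
Lemma hom_hjoin a b : f (hjoin a b) = hjoin (f a) (f b).
Proof. by rewrite /hjoin hf args2_comp. Qed.
Lemma hom_himp a b : f (himp a b) = himp (f a) (f b).
Proof. by rewrite /himp hf args2_comp. Qed.
Lemma hom_hbot : f (hbot A) = hbot B.
Proof. by rewrite /hbot hf args0_comp. Qed.
Lemma hom_htop : f (htop A) = htop B.
Proof. by rewrite /htop hf args0_comp. Qed.
End HeytingHom.

Section ModalHom.
Variables (A B : algebra modal_sig) (f : A -> B).

Lemma modal_homP :
  (forall a b, f (mmeet a b) = mmeet (f a) (f b)) ->
  (forall a b, f (mjoin a b) = mjoin (f a) (f b)) ->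
  (forall a, f (mneg a) = mneg (f a)) ->
  (forall a, f (mbox a) = mbox (f a)) ->
  f (mbot A) = mbot B -> f (mtop A) = mtop B -> is_hom f.
Proof.
move=> fM fJ fN fB f0 f1 [] /= x.
- rewrite [x]args2_eta; apply: etrans (fM _ _) _.
  by rewrite /mmeet -args2_comp.
- rewrite [x]args2_eta; apply: etrans (fJ _ _) _.
  by rewrite /mjoin -args2_comp.
- by rewrite [x]args1_eta; exact: fN.
- by rewrite [x]args1_eta; exact: fB.
- by rewrite [x]args0_eta; apply: etrans f0 _; rewrite args0_comp.
- by rewrite [x]args0_eta; apply: etrans f1 _; rewrite args0_comp.
Qed.

Hypothesis hf : is_hom f.

Lemma hom_mmeet a b : f (mmeet a b) = mmeet (f a) (f b).
Proof. by rewrite /mmeet hf args2_comp. Qed.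
Lemma hom_mjoin a b : f (mjoin a b) = mjoin (f a) (f b).
Proof. by rewrite /mjoin hf args2_comp. Qed.
Lemma hom_mneg a : f (mneg a) = mneg (f a).
Proof. by rewrite /mneg hf. Qed.
Lemma hom_mbox a : f (mbox a) = mbox (f a).
Proof. by rewrite /mbox hf. Qed.
Lemma hom_mbot : f (mbot A) = mbot B.
Proof. by rewrite /mbot hf args0_comp. Qed.
Lemma hom_mtop : f (mtop A) = mtop B.
Proof. by rewrite /mtop hf args0_comp. Qed.
Lemma hom_mimp a b : f (mimp a b) = mimp (f a) (f b).
Proof. by rewrite /mimp hom_mjoin hom_mneg. Qed.
End ModalHom.

(** * Transfer of sentences *)

Lemma map_du_nonempty (S S' : signature) (g : equation S -> equation S')
    (v : du_sentence S) :
  ~ (size (map g (premises v)) = 0 /\ size (map g (conclusions v)) = 0).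
Proof. by rewrite !size_map; exact: (@du_nonempty _ v). Qed.

(** Translating equation by equation keeps the number of premises and conclusions, so identities and
    quasi-identities keep their form. *)
Definition map_du (S S' : signature) (g : equation S -> equation S')
  (v : du_sentence S) : du_sentence S' := 
  DUSentence (@map_du_nonempty _ _ g v).

Lemma map_du_quasi_identity (S S' : signature) (g : equation S -> equation S')
    (v : du_sentence S) : is_quasi_identity v -> is_quasi_identity (map_du g v).
Proof. by rewrite /is_quasi_identity size_map. Qed.

Lemma map_du_identity (S S' : signature) (g : equation S -> equation S')
    (v : du_sentence S) : is_identity v -> is_identity (map_du g v).
Proof. by rewrite /is_identity !size_map. Qed.

Definition equations (S : signature) (v : du_sentence S) : seq (equation S) :=
  premises v ++ conclusions v.

Lemma Forall_map_iff (X Y : Type) (g : X -> Y) (P : X -> Prop) (Q : Y -> Prop)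
    (s : seq X) :
  (forall x, List.In x s -> P x <-> Q (g x)) ->
  List.Forall P s <-> List.Forall Q (map g s).
Proof.
elim: s => [|x s IH] PQ; first by split.
have PQx := PQ x (or_introl erefl).
have {}IH := IH (fun y ys => PQ y (or_intror ys)).
split=> /List.Forall_cons_iff [hx hs]; apply/List.Forall_cons_iff; tauto.
Qed.

Lemma Exists_map_iff (X Y : Type) (g : X -> Y) (P : X -> Prop) (Q : Y -> Prop)
    (s : seq X) :
  (forall x, List.In x s -> P x <-> Q (g x)) ->
  List.Exists P s <-> List.Exists Q (map g s).
Proof.
elim: s => [|x s IH] PQ /=; first by split=> /List.Exists_nil.
have PQx := PQ x (or_introl erefl).
have {}IH := IH (fun y ys => PQ y (or_intror ys)).
rewrite !List.Exists_cons; tauto.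
Qed.

Section Transfer.
Variables (S S' : signature) (A : algebra S) (B : algebra S').
Variables (g : equation S -> equation S') (v : du_sentence S).

Lemma map_du_env (envA : nat -> A) (envB : nat -> B) :
  (forall e, List.In e (equations v) -> eq_holds envA e <-> eq_holds envB (g e)) ->
  (List.Forall (eq_holds envA) (premises v) ->
   List.Exists (eq_holds envA) (conclusions v)) <->
  (List.Forall (eq_holds envB) (premises (map_du g v)) ->
   List.Exists (eq_holds envB) (conclusions (map_du g v))).
Proof.
move=> AB; have AB' e : List.In e (premises v) \/ List.In e (conclusions v) ->
    eq_holds envA e <-> eq_holds envB (g e).
  by move=> ev; apply: AB; exact: List.in_or_app.
have := Forall_map_iff (s := premises v) (fun e ev => AB' e (or_introl ev)).
have := Exists_map_iff (s := conclusions v) (fun e ev => AB' e (or_intror ev)).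
by move=> /=; tauto.
Qed.

Lemma satisfies_map_du :
  (forall envB : nat -> B, exists envA : nat -> A, forall e,
     eq_holds envA e <-> eq_holds envB (g e)) ->
  satisfies A v -> satisfies B (map_du g v).
Proof.
move=> ex Av envB; have [envA AB] := ex envB.
by apply: (map_du_env (fun e _ => AB e)).1; exact: Av.
Qed.

Lemma map_du_satisfies :
  (forall envA : nat -> A, exists envB : nat -> B, forall e,
     eq_holds envA e <-> eq_holds envB (g e)) ->
  satisfies B (map_du g v) -> satisfies A v.
Proof.
move=> ex Bv envA; have [envB AB] := ex envA.
by apply: (map_du_env (fun e _ => AB e)).2; exact: Bv.
Qed.
End Transfer.

(** Lets the transfer lemmas, which speak of [map_du g v], compare two algebras on one and the same
    sentence. *)
Lemma satisfies_map_id (S : signature) (A : algebra S) (v : du_sentence S) :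
  satisfies A (map_du id v) <-> satisfies A v.
Proof. by rewrite /satisfies /= !map_id. Qed.

Lemma satisfies_iso (S : signature) (A B : algebra S) (f : A -> B)
    (v : du_sentence S) : is_iso f -> satisfies A v <-> satisfies B v.
Proof.
move=> [hf [g fK gK]]; rewrite -(satisfies_map_id B).
split; [apply: satisfies_map_du => env; exists (fun n => g (env n))
       |apply: map_du_satisfies => env; exists (fun n => f (env n))] => e.
  rewrite /eq_holds; split=> [/(congr1 f)|ee]; last apply: (can_inj fK).
    by rewrite !eval_hom //; under eq_fun do rewrite gK.
  by rewrite !eval_hom //; under eq_fun do rewrite gK.
rewrite /eq_holds -!eval_hom //; split=> [->//|]; exact: (can_inj fK).
Qed.

(** * Boolean algebras with points *)

Definition hprime (A : algebra heyting_sig) : (A -> Prop) -> Prop :=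
  is_prime (@hmeet A) (@hjoin A) (hbot A) (htop A).

Definition mprime (M : algebra modal_sig) : (M -> Prop) -> Prop :=
  is_prime (@mmeet M) (@mjoin M) (mbot M) (mtop M).

Section Points.
Variables (M : algebra modal_sig) (hM : is_boolean_algebra M).
Let L := ba_lattice hM.

Lemma mprime_ext (a b : M) : (forall q, mprime q -> q a <-> q b) -> a = b.
Proof. exact: (prime_ext L (ba_distr hM)). Qed.

Lemma mprime_leP (a b : M) : (forall q, mprime q -> q a -> q b) <-> mle a b.
Proof.
split=> [ab|<- q qq /(filter_meet (prime_filter qq)) [] //].
apply: contrapT => /(prime_separation L (ba_distr hM)) [q qq [qa]].
by apply; exact: ab.
Qed.

Variables (q : M -> Prop) (qq : mprime q).

Lemma mprime_top : q (mtop M) = True.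
Proof. by apply: propext; split=> // _; exact: filter_top (prime_filter qq). Qed.

Lemma mprime_bot : q (mbot M) = False.
Proof. by apply: propext; split=> // /(prime_bot qq). Qed.

Lemma mprime_meet (a b : M) : q (mmeet a b) = (q a /\ q b).
Proof. by apply: propext; exact: filter_meet (prime_filter qq) _ _. Qed.

Lemma mprime_join (a b : M) : q (mjoin a b) = (q a \/ q b).
Proof. by apply: propext; exact: prime_join qq _ _. Qed.

Lemma mprime_neg (a : M) : q (mneg a) = ~ q a.
Proof.
have := mprime_meet a (mneg a); rewrite (ba_meetN hM) mprime_bot => e0.
have := mprime_join a (mneg a); rewrite (ba_joinN hM) mprime_top => e1.
apply: propext; split=> [na qa|]; first by rewrite e0.
by have [] : q a \/ q (mneg a) by rewrite -e1.
Qed.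

Lemma mprime_imp (a b : M) : q (mimp a b) = (q a -> q b).
Proof.
rewrite mprime_join mprime_neg; apply: propext.
by have := EM (q a); tauto.
Qed.

(** These are equalities of propositions, so rewriting turns membership of a Boolean combination
    into a propositional formula. *)
Definition mprimeE := (mprime_top, mprime_bot, mprime_meet, mprime_imp,
  mprime_join, mprime_neg).
End Points.

Section BoxFacts.
Variables (M : algebra modal_sig) (hM : is_interior_algebra M).
Let B := ma_boolean (ia_modal hM).

Lemma prime_box (q : M -> Prop) (a : M) : mprime q -> q (mbox a) -> q a.
Proof. by move=> qq; apply: (mprime_leP B _ _).2 (ia_box_le hM a) q qq. Qed.

(** As [o] is open, [o /\ []a = [](o /\ a)], and [o /\ a] lies below [b]. *)
Lemma box_local (o a b : M) : is_open o ->
  (forall q, mprime q -> q o -> q a -> q b) ->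
  forall q, mprime q -> q o -> q (mbox a) -> q (mbox b).
Proof.
move=> oo ab q qq qo qa.
have /(mprime_leP B) : mle (mbox (mmeet o a)) (mbox b).
  apply: mbox_mono => //; apply/(mprime_leP B) => r rr.
  by rewrite (mprimeE B rr) => -[]; exact: ab.
apply=> //; by rewrite (ma_boxI (ia_modal hM)) oo (mprimeE B qq).
Qed.

Lemma box_mono_prime (a b : M) :
  (forall q, mprime q -> q a -> q b) ->
  forall q, mprime q -> q (mbox a) -> q (mbox b).
Proof.
by move=> ab q qq; apply: (mprime_leP B _ _).2 q qq;
   apply: mbox_mono => //; apply/(mprime_leP B).
Qed.

Lemma val_hmeet (a b : opens hM) :
  proj1_sig (hmeet a b) = mmeet (proj1_sig a) (proj1_sig b).
Proof. by []. Qed.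
Lemma val_hjoin (a b : opens hM) :
  proj1_sig (hjoin a b) = mjoin (proj1_sig a) (proj1_sig b).
Proof. by []. Qed.
Lemma val_himp (a b : opens hM) :
  proj1_sig (himp a b) = mbox (mimp (proj1_sig a) (proj1_sig b)).
Proof. by []. Qed.
Lemma val_htop : proj1_sig (htop (opens hM)) = mtop M.
Proof. by []. Qed.

(** The lattice operations on open elements are those of [M], so prime filters pull back along
    [f]. *)
Lemma opens_prime (A : algebra heyting_sig) (f : A -> opens hM) (q : M -> Prop) :
  is_hom f -> mprime q -> hprime (fun a => q (proj1_sig (f a))).
Proof.
move=> hf qq; split=> [||a b].
- split=> [|a b]; first by rewrite (hom_htop hf) /= (mprimeE B qq).
  by rewrite (hom_hmeet hf) /= (mprimeE B qq).
- by rewrite (hom_hbot hf) /= (mprimeE B qq).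
- by rewrite (hom_hjoin hf) /= (mprimeE B qq).
Qed.
End BoxFacts.

(** * Conjunctive normal forms *)

Section NormalForms.
Variable A : algebra heyting_sig.

(* [:: (u1, w1); ...] stands for the element (~ u1 \/ w1) /\ ... of a Boolean
   extension of [A]. *)
Definition nf : Type := seq (A * A).

(** Distributivity, with [(~u \/ w) \/ (~u' \/ w') = ~(u /\ u') \/ (w \/ w')] for each pair of
    clauses. *)
Definition nf_join (l l' : nf) : nf :=
  [seq (hmeet c.1 c'.1, hjoin c.2 c'.2) | c <- l, c' <- l'].
Definition nf_bot : nf := [:: (htop A, hbot A)].
(** The negated clause [u /\ ~w] is written as the two clauses [~1 \/ u] and [~w \/ 0]. *)
Fixpoint nf_neg (l : nf) : nf :=
  if l is c :: l' then nf_join [:: (htop A, c.1); (c.2, hbot A)] (nf_neg l')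
  else nf_bot.
(** The interior of a normal form: [[]] distributes over the clauses, and [[](~u \/ w)] is the
    Heyting implication of open elements. *)
Definition nf_core (l : nf) : A :=
  foldr (fun c => hmeet (himp c.1 c.2)) (htop A) l.
Definition nf_open (a : A) : nf := [:: (htop A, a)].

Definition nf_algebra : algebra modal_sig :=
  @Algebra modal_sig nf (fun o =>
    match o return ('I_(modal_arity o) -> nf) -> nf with
    | MMeet => fun x => x ord0 ++ x ord_max
    | MJoin => fun x => nf_join (x ord0) (x ord_max)
    | MNeg => fun x => nf_neg (x ord0)
    | MBox => fun x => nf_open (nf_core (x ord0))
    | MBot => fun=> nf_bot
    | MTop => fun=> [::]
    end).

Definition nf_holds (p : A -> Prop) (l : nf) : Prop :=
  foldr (fun c P => (p c.1 -> p c.2) /\ P) True l.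

Variables (p : A -> Prop) (pp : hprime p).

Lemma nf_holds_meet (l l' : nf) :
  nf_holds p (l ++ l') = (nf_holds p l /\ nf_holds p l').
Proof.
apply: propext; elim: l => [|c l IH] /=; first by tauto.
by rewrite /nf_holds /= -!/(nf_holds _ _); tauto.
Qed.

Lemma nf_holds_join (l l' : nf) :
  nf_holds p (nf_join l l') = (nf_holds p l \/ nf_holds p l').
Proof.
apply: propext; elim: l => [|c l IH] /=; first by tauto.
rewrite /nf_join allpairs_cons nf_holds_meet -/(nf_join l l') {}IH.
have -> : nf_holds p [seq (hmeet c.1 x.1, hjoin c.2 x.2) | x <- l'] <->
    (p c.1 -> p c.2) \/ nf_holds p l'.
  elim: l' => [|c' l' IH] /=; first by tauto.
  rewrite /nf_holds /= -!/(nf_holds _ _) {}IH.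
  have := filter_meet (prime_filter pp) c.1 c'.1; have := prime_join pp c.2 c'.2.
  by have := EM (p c.1); have := EM (p c'.1); tauto.
by rewrite /nf_holds /= -!/(nf_holds _ _); tauto.
Qed.

Lemma nf_holds_bot : nf_holds p nf_bot = False.
Proof.
apply: propext; rewrite /nf_holds /=.
by have := prime_bot pp; have := filter_top (prime_filter pp); tauto.
Qed.

Lemma nf_holds_open (a : A) : nf_holds p (nf_open a) = p a.
Proof.
by apply: propext; rewrite /nf_holds /=; have := filter_top (prime_filter pp); tauto.
Qed.

Lemma nf_holds_neg (l : nf) : nf_holds p (nf_neg l) = ~ nf_holds p l.
Proof.
apply: propext; elim: l => [|c l IH].
  by rewrite [nf_neg _]/nf_bot nf_holds_bot /nf_holds /=; tauto.
rewrite [nf_neg _]/= nf_holds_join {}IH /nf_holds /= -!/(nf_holds _ _).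
have := prime_bot pp; have := filter_top (prime_filter pp).
by have := EM (p c.1); have := EM (p c.2); have := EM (nf_holds p l); tauto.
Qed.
End NormalForms.

(** A homomorphism [f] into the open elements of [M] interprets normal forms in [M]. *)
Section Denotation.
Variables (A : algebra heyting_sig) (M : algebra modal_sig).
Variables (hM : is_interior_algebra M) (f : A -> opens hM).
Let B := ma_boolean (ia_modal hM).

Definition den (l : nf_algebra A) : M :=
  foldr (fun c => mmeet (mimp (proj1_sig (f c.1)) (proj1_sig (f c.2)))) (mtop M) l.

Lemma den_cons (c : A * A) (l : nf A) : den (c :: l) =
  mmeet (mimp (proj1_sig (f c.1)) (proj1_sig (f c.2))) (den l).
Proof. by []. Qed.

Lemma prime_den (q : M -> Prop) (l : nf A) : mprime q ->
  q (den l) = nf_holds (fun a => q (proj1_sig (f a))) l.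
Proof.
move=> qq; elim: l => [|c l IH] /=; first by rewrite (mprimeE B qq).
by rewrite !(mprimeE B qq) IH.
Qed.

Hypothesis hf : is_hom f.

Lemma den_core (l : nf A) : proj1_sig (f (nf_core l)) = mbox (den l).
Proof.
elim: l => [|c l IH] /=; first by rewrite (hom_htop hf) /= (ma_box1 (ia_modal hM)).
by rewrite (hom_hmeet hf) /= IH (ma_boxI (ia_modal hM)) (hom_himp hf).
Qed.

Lemma den_open (a : A) : den (nf_open a) = proj1_sig (f a).
Proof.
apply: (mprime_ext B) => q qq; rewrite prime_den //.
by rewrite nf_holds_open //; exact: opens_prime.
Qed.

Lemma den_hom : is_hom den.
Proof.
have pq q : mprime q -> hprime (fun a => q (proj1_sig (f a))) by exact: opens_prime.
apply: modal_homP => [l l'|l l'|l|l||//].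
- by apply: (mprime_ext B) => q qq; rewrite (mprimeE B qq) !prime_den // nf_holds_meet.
- apply: (mprime_ext B) => q qq; rewrite (mprimeE B qq) !prime_den //.
  by rewrite nf_holds_join //; exact: pq.
- apply: (mprime_ext B) => q qq; rewrite (mprimeE B qq) !prime_den //.
  by rewrite nf_holds_neg //; exact: pq.
- by rewrite -den_core -den_open.
- apply: (mprime_ext B) => q qq; rewrite (mprimeE B qq) !prime_den //.
  by rewrite nf_holds_bot //; exact: pq.
Qed.

(** Turns an equation between modal elements into a Heyting equation: [[](x <-> y) = 1] forces
    [x = y] because [[]z] is below [z]. *)
Lemma box_iffE (l l' : nf_algebra A) :
  proj1_sig (f (nf_core (mmeet (mimp l l') (mimp l' l)))) = mtop M <->
  den l = den l'.
Proof.
rewrite den_core (hom_mmeet den_hom) !(hom_mimp den_hom); split=> [e|->].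
  apply: (mprime_ext B) => q qq.
  have : q (mtop M) by rewrite (mprimeE B qq).
  by rewrite -e => /(prime_box hM qq); rewrite !(mprimeE B qq) => -[].
rewrite -[RHS](ma_box1 (ia_modal hM)); congr mbox.
by apply: (mprime_ext B) => q qq; rewrite !(mprimeE B qq); tauto.
Qed.
End Denotation.

Lemma hom_den (A : algebra heyting_sig) (M N : algebra modal_sig)
    (hM : is_interior_algebra M) (hN : is_interior_algebra N)
    (f : A -> opens hM) (f' : A -> opens hN) (g : M -> N) :
  is_hom g -> (forall a, g (proj1_sig (f a)) = proj1_sig (f' a)) ->
  forall l, g (den f l) = den f' l.
Proof.
move=> hg gf; elim=> [|c l IH] /=; first exact: hom_mtop.
by rewrite (hom_mmeet hg) (hom_mimp hg) !gf IH.
Qed.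

(** * Free Boolean extensions *)

Section HeytingPoints.
Variables (H : algebra heyting_sig) (hH : is_heyting_algebra H).
Let L := hH.1.

(** Meeting with [z] has implication as right adjoint, so it preserves joins. *)
Lemma heyting_distr : left_distributive (@hmeet H) (@hjoin H).
Proof.
have idem (a : H) : hmeet a a = a by rewrite -{2}(bl_joinK L a a) (bl_meetK L).
have joinE (a b : H) : hle a b <-> hjoin a b = b.
  split=> [<-|<-]; last exact: (bl_meetK L).
  by rewrite (bl_meetC L) (bl_joinC L) (bl_joinK L).
have lej (a b c : H) : hle a c -> hle b c -> hle (hjoin a b) c.
  by move=> /joinE ac /joinE bc; apply/joinE; rewrite -(bl_joinA L) bc.
have joinl (a b : H) : hle a (hjoin a b) by exact: (bl_meetK L).
have joinr (a b : H) : hle b (hjoin a b) by rewrite (bl_joinC L); exact: joinl.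
have meetS (a b c : H) : hle a b -> hle (hmeet a c) (hmeet b c).
  rewrite /hle => ab; rewrite (bl_meetC L b) (bl_meetA L) -(bl_meetA L a) idem.
  by rewrite -(bl_meetA L) (bl_meetC L c) (bl_meetA L) ab.
move=> x y z; set R := hjoin (hmeet x z) _.
have le : hle (hmeet (hjoin x y) z) R.
  by apply/hH.2; apply: lej; apply/hH.2; [exact: joinl|exact: joinr].
have ge : hle R (hmeet (hjoin x y) z).
  by apply: lej; apply: meetS; [exact: joinl|exact: joinr].
by rewrite -le (bl_meetC L).
Qed.

Lemma heyting_point_exists (F : H -> Prop) (b : H) :
  is_filter (@hmeet H) (htop H) F -> ~ F b ->
  exists2 p, hprime p & (forall a, F a -> p a) /\ ~ p b.
Proof. exact: (prime_filter_exists L heyting_distr). Qed.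

Lemma hprime_ext (a b : H) : (forall p, hprime p -> p a <-> p b) -> a = b.
Proof. exact: (prime_ext L heyting_distr). Qed.

Lemma hprime_le (p : H -> Prop) (a b : H) : hprime p -> hle a b -> p a -> p b.
Proof. by move=> pp <- /(filter_meet (prime_filter pp)) []. Qed.

(** The Kripke clause for implication, over the prime filters of [H] ordered by inclusion. *)
Lemma hprime_imp (p : H -> Prop) (u w : H) : hprime p ->
  p (himp u w) <->
  forall y : H -> Prop, hprime y -> (forall a, p a -> y a) -> y u -> y w.
Proof.
have idem (a : H) : hmeet a a = a by rewrite -{2}(bl_joinK L a a) (bl_meetK L).
move=> pp; have filp := prime_filter pp; split=> [puw y yy py yu|up].
  apply: (hprime_le yy).
    2: exact: (filter_meet (prime_filter yy) _ _).2 (conj (py _ puw) yu).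
  by apply/hH.2; exact: idem.
apply: contrapT => npuw.
have adj a b : hle a (himp u b) <-> hle (hmeet a u) b by exact: hH.2.
(* The elements [z] with [himp u z] in [p] form the filter generated by [p] and [u]; it omits
   [w]. *)
have [||y yy [Fy nyw]] := @heyting_point_exists (fun z => p (himp u z)) w => //.
  split.
    apply: (hprime_le pp) (filter_top filp); apply/adj; exact: (bl_meet1 L).
  have impS a b : hle a b -> hle (himp u a) (himp u b).
    move=> ab; apply/adj; have ca := (adj (himp u a) a).1 (idem _).
    by rewrite /hle -ca -(bl_meetA L _ a b) ab.
  move=> a b; split=> [pab|[pa pb]].
    split; apply: (hprime_le pp _ pab); apply: impS.
      by rewrite /hle (bl_meetC L) (bl_meetA L) idem.
    by rewrite /hle -(bl_meetA L) idem.
  apply: (hprime_le pp) ((filter_meet filp _ _).2 (conj pa pb)).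
  apply/adj; rewrite /hle (bl_meetA L).
  set c := himp u a; set d := himp u b.
  have ca : hmeet (hmeet c u) a = hmeet c u by exact: (adj _ _).1 (idem _).
  have db : hmeet (hmeet d u) b = hmeet d u by exact: (adj _ _).1 (idem _).
  rewrite -(bl_meetA L c) (bl_meetC L d) (bl_meetA L c).
  rewrite -(bl_meetA L _ d a) (bl_meetC L d) (bl_meetA L _ a) ca.
  by rewrite -(bl_meetA L c) (bl_meetC L u) -(bl_meetA L) db.
apply: nyw; apply: up => // [a pa|].
  apply: Fy; apply: (hprime_le pp) pa; apply/adj.
  by rewrite /hle (bl_meetC L a) -(bl_meetA L) idem.
apply: Fy; apply: (hprime_le pp) (filter_top filp); apply/adj.
by rewrite /hle (bl_meetC L (htop H)) (bl_meet1 L) idem.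
Qed.
End HeytingPoints.

(** * B(H) as an algebra of sets of prime filters *)

Section Construction.
Variables (H : algebra heyting_sig) (hH : is_heyting_algebra H).

Definition point : Type := {p : H -> Prop | hprime p}.
Definition val_point (x : point) : H -> Prop := proj1_sig x.
Lemma val_pointP (x : point) : hprime (val_point x).
Proof. exact: proj2_sig x. Qed.

(** These sets form the Boolean algebra generated by the sets of prime filters containing a given
    element of [H]. *)
Definition is_nf (S : point -> Prop) : Prop :=
  exists l : nf H, forall x, S x = nf_holds (val_point x) l.

Definition ext_carrier : Type := {S : point -> Prop | is_nf S}.
Implicit Types S : ext_carrier.

Definition nf_class (l : nf H) : ext_carrier :=
  exist is_nf (fun x => nf_holds (val_point x) l)
    (ex_intro _ l (fun=> erefl)).

Definition nf_repr S : nf H := proj1_sig (cid (proj2_sig S)).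

Lemma nf_reprE S x : nf_holds (val_point x) (nf_repr S) = proj1_sig S x.
Proof. by rewrite /nf_repr; case: cid. Qed.

Lemma ext_ext S S' : (forall x, proj1_sig S x <-> proj1_sig S' x) -> S = S'.
Proof.
case: S S' => [S hS] [S' hS'] /= SS'.
by apply: eq_exist; apply: funext => x; exact: propext.
Qed.

(** Operations are computed on chosen normal forms. By [extE] the results depend only on the sets,
    and [mbox] is the interior for inclusion of prime filters. *)
Definition boolean_extension : algebra modal_sig :=
  @Algebra modal_sig ext_carrier (fun o x =>
    nf_class (interp (a := nf_algebra H) (fun k => nf_repr (x k)))).

Local Notation BH := boolean_extension.
Implicit Types a b : BH.

Lemma extE_meet a b x :
  proj1_sig (mmeet a b) x = (proj1_sig a x /\ proj1_sig b x).
Proof. by rewrite /= nf_holds_meet !nf_reprE. Qed.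

Lemma extE_join a b x :
  proj1_sig (mjoin a b) x = (proj1_sig a x \/ proj1_sig b x).
Proof. by rewrite /= nf_holds_join ?nf_reprE //; exact: val_pointP. Qed.

Lemma extE_neg a x : proj1_sig (mneg a) x = ~ proj1_sig a x.
Proof. by rewrite /= nf_holds_neg ?nf_reprE //; exact: val_pointP. Qed.

Lemma extE_bot x : proj1_sig (mbot BH) x = False.
Proof. exact: nf_holds_bot (val_pointP x). Qed.

Lemma extE_top x : proj1_sig (mtop BH) x = True.
Proof. by []. Qed.

(** Clause by clause, this is [hprime_imp]. *)
Lemma nf_holds_core (l : nf H) x :
  val_point x (nf_core l) <->
  forall y, (forall h, val_point x h -> val_point y h) -> nf_holds (val_point y) l.
Proof.
have filx := prime_filter (val_pointP x).
elim: l => [|c l IH] /=; first by split=> // _; exact: filter_top filx.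
rewrite (filter_meet filx) IH (hprime_imp hH _ _ (val_pointP x)).
split=> [[xc xl] y xy|xcl]; first by split; [exact: (xc _ (val_pointP y))|exact: xl].
by split=> [y yy xy|y /xcl []//]; case: (xcl (exist _ y yy)).
Qed.

Lemma extE_box a x : proj1_sig (mbox a) x =
  forall y : point, (forall h, val_point x h -> val_point y h) -> proj1_sig a y.
Proof.
rewrite [LHS](nf_holds_open (val_pointP x) (nf_core (nf_repr a))).
apply: propext; rewrite nf_holds_core.
by split=> xa y xy; [rewrite -nf_reprE|rewrite nf_reprE]; exact: xa.
Qed.

Definition extE := (extE_meet, extE_join, extE_neg, extE_bot, extE_top, extE_box).

Lemma boolean_extension_interior : is_interior_algebra BH.
Proof.
split; first split; first split; first split.
all: try by move=> a; try move=> b; try move=> c; apply: ext_ext => x;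
  rewrite !extE; try have := EM (proj1_sig a x); tauto.
- move=> a b; apply: ext_ext => x; rewrite !extE; split=> [ab|[xa xb] y xy].
    by split=> y /ab; rewrite extE => -[].
  by rewrite extE; split; [exact: xa|exact: xb].
- by apply: ext_ext => x; rewrite !extE.
- move=> a; apply: ext_ext => x; rewrite !extE; split=> ha y xy.
    by have := ha y xy; rewrite extE; apply.
  by rewrite extE => z yz; apply: ha => h /xy /yz.
- move=> a; apply: ext_ext => x; rewrite !extE; split=> [[]//|ha].
  by split=> //; apply: ha.
Qed.
Let hB := boolean_extension_interior.

Lemma extE_open (h : H) x : proj1_sig (nf_class (nf_open h)) x = val_point x h.
Proof. exact: nf_holds_open (val_pointP x) h. Qed.

Lemma nf_class_open (h : H) : is_open (nf_class (nf_open h) : BH).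
Proof.
apply: ext_ext => x; rewrite extE extE_open.
split=> [xh|xh y xy]; last by rewrite extE_open; exact: xy.
by have := xh x (fun _ => id); rewrite extE_open.
Qed.

Definition ext_inj (h : H) : opens hB := exist _ _ (nf_class_open h).

Lemma ext_injE (h : H) x : proj1_sig (proj1_sig (ext_inj h)) x = val_point x h.
Proof. exact: extE_open. Qed.

Lemma ext_inj_hom : is_hom ext_inj.
Proof.
apply: heyting_homP => [a b|a b|a b||]; apply: open_elt_inj; apply: ext_ext => x;
  rewrite ext_injE.
- by rewrite val_hmeet extE !ext_injE;
     exact: filter_meet (prime_filter (val_pointP x)) _ _.
- by rewrite val_hjoin extE !ext_injE;
     exact: prime_join (val_pointP x) _ _.
- rewrite (hprime_imp hH _ _ (val_pointP x)) val_himp.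
  rewrite extE; split=> [xab y xy|xab y yy xy].
    rewrite !extE !ext_injE; have := xab _ (val_pointP y) xy.
    by rewrite -/(val_point y); have := EM (val_point y a); tauto.
  have := xab (exist _ y yy) xy; rewrite !extE !ext_injE /=; tauto.
- by [].
- rewrite val_htop extE; split=> // _.
  exact: filter_top (prime_filter (val_pointP x)).
Qed.

Lemma den_ext_inj (l : nf H) : den ext_inj l = nf_class l.
Proof.
apply: ext_ext => x; elim: l => [|c l IH]; first by rewrite extE.
by rewrite den_cons /mimp !extE !ext_injE IH /=; have := EM (val_point x c.1); tauto.
Qed.

Lemma ext_inj_iso : is_iso ext_inj.
Proof.
split; first exact: ext_inj_hom.
have inj : injective ext_inj.
  move=> h h' e; apply: (hprime_ext hH) => p pp.
  by have := ext_injE h (exist _ p pp); rewrite e ext_injE /= => ->.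
have surj (S : opens hB) : exists h, ext_inj h = S.
  (* An open set equals its interior, which [nf_core] of any of its normal forms represents. *)
  exists (nf_core (nf_repr (proj1_sig S))); apply: open_elt_inj.
  rewrite (den_core ext_inj_hom) den_ext_inj -[RHS](proj2_sig S); congr mbox.
  by apply: ext_ext => x; rewrite /= nf_reprE.
have [g gK] := choice surj.
by exists g => // h; apply: inj; rewrite gK.
Qed.

Section Extension.
Variables (N : algebra modal_sig) (hN : is_interior_algebra N) (f : H -> opens hN).
Hypothesis hf : is_hom f.
Let B := ma_boolean (ia_modal hN).

Definition extension (S : BH) : N := den f (nf_repr S).

(* A prime filter of [N] pulls back to a prime filter of [H] along [f]. *)
Lemma den_nf_class (l l' : nf H) : nf_class l = nf_class l' -> den f l = den f l'.
Proof.
move=> ll'; apply: (mprime_ext B) => q qq; rewrite !prime_den //.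
have pq := opens_prime hf qq.
by have /= -> := congr1 (fun S : BH => proj1_sig S (exist _ _ pq)) ll'.
Qed.

Lemma nf_reprK S : nf_class (nf_repr S) = S.
Proof. by apply: ext_ext => x; rewrite /= nf_reprE. Qed.

Lemma extension_class (l : nf H) : extension (nf_class l) = den f l.
Proof. by apply: den_nf_class; rewrite nf_reprK. Qed.

Lemma extension_hom : is_hom extension.
Proof. by move=> o x; rewrite /= extension_class (den_hom hf). Qed.

Lemma extension_inj h : extension (proj1_sig (ext_inj h)) = proj1_sig (f h).
Proof. by rewrite extension_class den_open. Qed.

Lemma extension_unique (g : BH -> N) : is_hom g ->
  (forall h, g (proj1_sig (ext_inj h)) = proj1_sig (f h)) -> g = extension.
Proof.
move=> hg gi; apply: funext => S.
by rewrite -(nf_reprK S) extension_class -den_ext_inj (hom_den hg gi).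
Qed.
End Extension.

Lemma boolean_extension_free : is_free_boolean_extension ext_inj.
Proof.
split; first exact: ext_inj_iso.
- move=> N hN j hj jinj; exists (extension j); split.
  + exact: extension_hom.
  (* Equality of denotations in [N] is a Heyting equation by [box_iffE]; the injective [j] reflects
     it to [H], and [box_iffE] in B(H) turns it back. *)
  + move=> S S'; rewrite /extension -(box_iffE hj) => e.
    have := box_iffE ext_inj_hom (nf_repr S) (nf_repr S').
    rewrite !den_ext_inj !nf_reprK => -[+ _]; apply.
    rewrite (_ : nf_core _ = htop H) ?(hom_htop ext_inj_hom) //.
    by apply: jinj; apply: open_elt_inj; rewrite e (hom_htop hj).
  + exact: extension_inj.
  + move=> y; split=> [[S <-] P subP jP|].
      rewrite /extension; elim: (nf_repr S) => [|c l IH] /=.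
        by apply: (subP MTop) => -[].
      apply: (subP MMeet) => -[[|k] hk] //=.
      apply: (subP MJoin) => -[[|k'] hk'] /=; last by apply: jP; exists c.2.
      by apply: (subP MNeg) => k'' /=; apply: jP; exists c.1.
    move=> gen; apply: (gen (fun z => exists S, extension j S = z)).
      exact: image_subuniverse (extension_hom hj).
    by move=> _ [h ->]; exists (proj1_sig (ext_inj h)); exact: extension_inj.
- move=> N hN f hf; exists (extension f); split.
    by split; [exact: extension_hom|exact: extension_inj].
  by move=> g [hg gi]; rewrite (extension_unique hf hg gi).
Qed.
End Construction.

(** * Quasi-maximal parts *)

Section Kernel.
Variables (M : algebra modal_sig) (hM : is_interior_algebra M).
Let B := ma_boolean (ia_modal hM).

(* In the dual preorder [d] is left above a point of [kernel d] only for good. *)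
Definition kernel (d : M) : M := mmeet d (mbox (mjoin d (mbox (mneg d)))).

(* The Grzegorczyk axiom for [mneg d]: every point of [d] sees one of [kernel d]. *)
Definition cofinal_kernel (d : M) : Prop :=
  forall q, mprime q -> q d -> ~ q (mbox (mneg (kernel d))).

(** The left-hand side of the Grzegorczyk inequality for [a] equals [[]~(kernel (~a))]. *)
Lemma cofinal_kernelE (a : M) :
  mle (mbox (mimp (mbox (mimp a (mbox a))) a)) a <-> cofinal_kernel (mneg a).
Proof.
have box_eq (x y : M) : (forall q, mprime q -> q x <-> q y) -> mbox x = mbox y.
  by move=> xy; congr mbox; exact: (mprime_ext B).
have nn : mneg (mneg a) = a.
  by apply: (mprime_ext B) => q qq; rewrite !(mprimeE B qq);
     have := EM (q a); tauto.
have -> : mbox (mimp (mbox (mimp a (mbox a))) a) = mbox (mneg (kernel (mneg a))).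
  apply: box_eq => q qq; rewrite !(mprimeE B qq) nn.
  by have := EM (q a); rewrite -/(mimp a (mbox a)); tauto.
split=> [/(mprime_leP B) le q qq|co]; first rewrite (mprimeE B qq).
  by have := le q qq; tauto.
apply/(mprime_leP B) => q qq; have := co q qq; rewrite (mprimeE B qq).
by have := EM (q a); tauto.
Qed.

(** Boxes are local on open elements, so [d] and [d'], which agree on [o], have kernels that agree
    there. *)
Lemma cofinal_kernel_local (o d d' : M) : is_open o -> cofinal_kernel d' ->
  (forall q, mprime q -> q o -> (q d <-> q d')) ->
  forall q, mprime q -> q o -> q d -> ~ q (mbox (mneg (kernel d))).
Proof.
move=> oo co dd' q qq qo qd.
have := co q qq ((dd' q qq qo).1 qd).
apply: contra_not; apply: (box_local hM oo) => // r rr ro.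
rewrite !(mprimeE B rr) => nk [d'r br]; apply: nk.
split; first exact: (dd' r rr ro).2.
apply: (box_local hM oo) br => // s ss so; rewrite !(mprimeE B ss) => -[d's|br'].
  by left; apply: (dd' s ss so).2.
right; apply: (box_local hM oo) br' => // t tt to_; rewrite !(mprimeE B tt).
by apply: contra_not; exact: (dd' t tt to_).1.
Qed.

(** Quantifying over all open [u] strengthens the property enough to survive case distinctions on
    open elements. *)
Let relatively_cofinal (c : M) : Prop :=
  forall u, is_open u -> cofinal_kernel (mmeet c (mneg u)).

Let shannon (v c1 c0 : M) : M := mjoin (mmeet v c1) (mmeet (mneg v) c0).

(* Below [v] the element is [c1]; on the open set of points that see no point
   of the first part it is [c0] with [u] replaced by [mjoin u v]. *)
Let relatively_cofinal_shannon (v c1 c0 : M) : is_open v ->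
  relatively_cofinal c1 -> relatively_cofinal c0 ->
  relatively_cofinal (shannon v c1 c0).
Proof.
move=> ov co1 co0 u ou; set d := mmeet _ _.
have dE q : mprime q -> q d = ((q v /\ q c1 \/ ~ q v /\ q c0) /\ ~ q u).
  by move=> qq; rewrite /d !(mprimeE B qq).
clearbody d.
have on_v : forall q, mprime q -> q v -> q d -> ~ q (mbox (mneg (kernel d))).
  apply: (cofinal_kernel_local ov (co1 u ou)) => q qq qv.
  by rewrite dE // !(mprimeE B qq); tauto.
pose o := mbox (mneg (mmeet v d)).
have on_o : forall q, mprime q -> q o -> q d -> ~ q (mbox (mneg (kernel d))).
  apply: (cofinal_kernel_local (open_box hM _) (co0 _ (open_join hM ou ov))) => q qq.
  move=> /(prime_box hM qq); rewrite !(mprimeE B qq) dE //.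
  by have := EM (q v); tauto.
(* A point outside [o] sees a point of [v /\ d], which by [on_v] sees one of [kernel d]. *)
move=> q qq qd qk; case: (EM (q o)) => [qo|]; first exact: on_o qk.
apply; move: qk; rewrite -[mbox (mneg _)](ia_box_box hM).
apply: (box_mono_prime hM) => // r rr; rewrite !(mprimeE B rr) => rk [rv rd].
exact: on_v rk.
Qed.

(** Induction on the clauses, by case distinctions on the open elements that occur in them. *)
Lemma den_cofinal (A : algebra heyting_sig) (f : A -> opens hM) (l : nf A) :
  cofinal_kernel (mneg (den f l)).
Proof.
have ext (a b : M) : (forall q, mprime q -> q a <-> q b) -> a = b.
  exact: (mprime_ext B).
(* The kernel of [~u] is [~u] itself, since [~u \/ []u = 1] for open [u]. *)
have top : relatively_cofinal (mtop M).
  move=> u ou q qq; rewrite !(mprimeE B qq) => -[_ nu] /(prime_box hM qq).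
  rewrite !(mprimeE B qq); apply; split=> //.
  set z := mjoin _ _; suff -> : z = mtop M.
    by rewrite (ma_box1 (ia_modal hM)) (mprimeE B qq).
  have -> : z = mjoin (mneg u) (mbox u).
    congr (mjoin _ (mbox _)); apply: ext => r rr; rewrite !(mprimeE B rr).
      by tauto.
    by have := EM (r u); tauto.
  by rewrite ou; apply: ext => r rr; rewrite !(mprimeE B rr); have := EM (r u); tauto.
have bot : relatively_cofinal (mbot M).
  by move=> u ou q qq; rewrite !(mprimeE B qq) => -[].
have rel : relatively_cofinal (mneg (den f l)).
  elim: l => [|c l IH].
    have <- // : mbot M = mneg (mtop M).
    by apply: ext => q qq; rewrite !(mprimeE B qq); tauto.
  pose u := proj1_sig (f c.1); pose w := proj1_sig (f c.2).
  (* The first clause fails exactly on [u /\ ~w], where the negation is [1]; elsewhere the remaining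
     clauses decide. *)
  have -> : mneg (den f (c :: l)) =
      shannon u (shannon w (mneg (den f l)) (mtop M)) (mneg (den f l)).
    apply: ext => q qq; rewrite den_cons !(mprimeE B qq).
    by rewrite -/u -/w; have := EM (q u); have := EM (q w); tauto.
  do 2 (apply: relatively_cofinal_shannon => //; first exact: proj2_sig).
have := rel _ (open_bot hM); congr cofinal_kernel.
by apply: ext => q qq; rewrite !(mprimeE B qq); tauto.
Qed.

Lemma grzegorczyk_cofinal (hg : is_grzegorczyk_algebra M) (d : M) :
  cofinal_kernel d.
Proof.
have <- : mneg (mneg d) = d.
  by apply: (mprime_ext B) => q qq; rewrite !(mprimeE B qq);
     have := EM (q d); tauto.
exact/cofinal_kernelE/hg.2.
Qed.
End Kernel.

(** The embedding given by generation with [j = i] is the identity by uniqueness, so the open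
    elements generate [M]; denotations form a subuniverse containing them. *)
Lemma free_boolean_extension_den (H : algebra heyting_sig) (M : algebra modal_sig)
    (hM : is_interior_algebra M) (i : H -> opens hM) (y : M) :
  is_free_boolean_extension i -> exists l, den i l = y.
Proof.
move=> [[hi bi] gen ext].
have [k [hk _ ki kgen]] := gen M hM i hi (bij_inj bi).
have [g [_ guniq]] := ext M hM i hi.
have kid : k = id.
  by rewrite -(guniq k) // -(guniq id) //; split.
have /kgen gen_y : exists x, k x = y by exists y; rewrite kid.
apply: (gen_y (fun z => exists l, den i l = z)).
  exact: image_subuniverse (den_hom hi).
by move=> _ [h ->]; exists (nf_open h); exact: den_open.
Qed.

Lemma free_boolean_extension_grzegorczyk (H : algebra heyting_sig)
    (M : algebra modal_sig) (hM : is_interior_algebra M) (i : H -> opens hM) :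
  is_free_boolean_extension i -> is_grzegorczyk_algebra M.
Proof.
move=> hfree; split=> // a; apply/(cofinal_kernelE hM).
by have [l <-] := free_boolean_extension_den a hfree; exact: den_cofinal.
Qed.

(** * Partial homomorphisms *)

Section PartialHom.
Variables (S : signature) (A : algebra S).

(** Both arguments and value must lie in [s]; this suffices to commute with evaluation when [s]
    contains the values of all subterms. *)
Definition partial_hom (B : algebra S) (s : seq A) (f : A -> B) : Prop :=
  forall (o : op S) (x : 'I_(arity o) -> A),
    (forall k, List.In (x k) s) -> List.In (interp x) s ->
    f (interp x) = interp (fun k => f (x k)).

Variable env : nat -> A.

Fixpoint covers (s : seq A) (t : term S) : Prop :=
  List.In (eval env t) s /\
  match t with Var _ => True | App o ts => forall k, covers s (ts k) end.

Lemma covers_eval (s : seq A) (t : term S) : covers s t -> List.In (eval env t) s.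
Proof. by case: t => [n|o ts] []. Qed.

Lemma covers_mono (s s' : seq A) (t : term S) :
  (forall a, List.In a s -> List.In a s') -> covers s t -> covers s' t.
Proof.
move=> ss'; elim: t => [n|o ts IH] /= [ts_in cov]; split=> //; try exact: ss'.
by move=> k; exact: IH.
Qed.

Lemma In_flatten_map (I : eqType) (F : I -> seq A) (r : seq I) (i : I) (a : A) :
  i \in r -> List.In a (F i) -> List.In a (flatten (map F r)).
Proof.
elim: r => // j r IH; rewrite inE => /orP [/eqP <-|ir] aF /=;
  apply: List.in_or_app; [by left|right; exact: IH].
Qed.

Lemma covers_exists (t : term S) : exists s, covers s t.
Proof.
elim: t => [n|o ts IH]; first by exists [:: env n]; split=> //; left.
have [F FP] := choice IH.
exists (eval env (App ts) :: flatten (map F (enum 'I_(arity o)))).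
split; [by left|move=> k].
apply: covers_mono (FP k) => a aF; right.
by apply: In_flatten_map aF; rewrite mem_enum.
Qed.

Lemma covers_equations (es : seq (equation S)) :
  exists s, forall e, List.In e es -> covers s e.1 /\ covers s e.2.
Proof.
elim: es => [|e es [s sP]]; first by exists [::].
have [s1 s1P] := covers_exists e.1; have [s2 s2P] := covers_exists e.2.
exists (s1 ++ s2 ++ s) => e' /= [<-|/sP [c1 c2]].
  split; [apply: covers_mono s1P|apply: covers_mono s2P] => a ha;
    apply: List.in_or_app; [by left|right; apply: List.in_or_app; by left].
by split; [apply: covers_mono c1|apply: covers_mono c2] => a ha;
  apply: List.in_or_app; right; apply: List.in_or_app; right.
Qed.

Lemma partial_hom_eval (B : algebra S) (s : seq A) (f : A -> B) (t : term S) :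
  partial_hom s f -> covers s t -> f (eval env t) = eval (fun n => f (env n)) t.
Proof.
move=> hf; elim: t => //= o ts IH [t_in cov]; rewrite hf //.
  by congr interp; apply: funext => k; exact: IH.
by move=> k; exact: covers_eval.
Qed.
End PartialHom.

(** * Approximating a Grzegorczyk algebra by its open elements *)

Section Approximation.
Variables (M : algebra modal_sig) (hM : is_interior_algebra M).
Let B := ma_boolean (ia_modal hM).

Definition generated_by_opens (c : M) : Prop :=
  exists l : nf (opens hM), den id l = c.
Local Notation gen := generated_by_opens.

Let hid : is_hom (id : opens hM -> opens hM). Proof. by []. Qed.

Lemma gen_top : gen (mtop M).
Proof. by exists [::]. Qed.
Lemma gen_bot : gen (mbot M).
Proof. by exists (mbot (nf_algebra _)); exact: hom_mbot (den_hom hid). Qed.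
Lemma gen_meet a b : gen a -> gen b -> gen (mmeet a b).
Proof.
move=> [l <-] [l' <-]; exists (mmeet (l : nf_algebra _) l').
exact: hom_mmeet (den_hom hid) _ _.
Qed.
Lemma gen_join a b : gen a -> gen b -> gen (mjoin a b).
Proof.
move=> [l <-] [l' <-]; exists (mjoin (l : nf_algebra _) l').
exact: hom_mjoin (den_hom hid) _ _.
Qed.
Lemma gen_neg a : gen a -> gen (mneg a).
Proof.
move=> [l <-]; exists (mneg (l : nf_algebra _)).
exact: hom_mneg (den_hom hid) _.
Qed.
Lemma gen_box a : gen (mbox a).
Proof.
exists (nf_open (exist _ _ (open_box hM a) : opens hM)).
exact: den_open hid _.
Qed.

(* A point of [mbox (mjoin d (mbox (mneg d)))] lies in [d] as soon as it lies
   outside the open element [mbox (mneg d)]. *)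
Lemma gen_kernel d : gen (kernel d).
Proof.
have -> : kernel d = mmeet (mbox (mjoin d (mbox (mneg d)))) (mneg (mbox (mneg d))).
  apply: (mprime_ext B) => q qq; rewrite !(mprimeE B qq).
  have := prime_box hM (a := mneg d) qq.
  have := prime_box hM (a := mjoin d (mbox (mneg d))) qq.
  by rewrite !(mprimeE B qq); have := EM (q d); tauto.
by apply: gen_meet; [|apply: gen_neg]; exact: gen_box.
Qed.

Definition agree (s : seq M) (q q' : M -> Prop) : Prop :=
  forall a, List.In a s -> q a <-> q' a.

(** A property of points that depends only on finitely many generated elements is a Boolean
    combination of them. *)
Lemma gen_determined (s : seq M) (P : (M -> Prop) -> Prop) :
  (forall a, List.In a s -> gen a) ->
  (forall q q', mprime q -> mprime q' -> agree s q q' -> P q -> P q') ->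
  exists2 c, gen c & forall q, mprime q -> q c <-> P q.
Proof.
elim: s P => [|k s IH] P gs Pdet.
  case: (EM (exists2 q, mprime q & P q)) => [[q qq Pq]|noP].
    exists (mtop M); first exact: gen_top.
    by move=> q' qq'; rewrite (mprimeE B qq'); split=> // _; exact: Pdet Pq.
  exists (mbot M); first exact: gen_bot.
  by move=> q qq; rewrite (mprimeE B qq); split=> // Pq; apply: noP; exists q.
(* To forget [k], fix its sign by [Q] and ask for some point of that sign with the same trace on [s]
   and property [P]. *)
have part (Q : (M -> Prop) -> Prop) : exists2 c, gen c & forall q, mprime q ->
    q c <-> exists q', [/\ mprime q', Q q', agree s q q' & P q'].
  apply: IH => [a ha|q q' qq qq' qq'_agree [r [rr Qr qr Pr]]].
    by apply: gs; right.
  exists r; split=> // a ha; rewrite -(qr a ha).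
  exact: iff_sym (qq'_agree a ha).
have [c1 gc1 c1P] := part (fun q => q k).
have [c0 gc0 c0P] := part (fun q => ~ q k).
exists (mjoin (mmeet k c1) (mmeet (mneg k) c0)).
  have gk : gen k by apply: gs; left.
  by apply: gen_join; apply: gen_meet => //; exact: gen_neg.
move=> q qq; rewrite !(mprimeE B qq) c1P // c0P //.
have Pqr r : mprime r -> agree s q r -> (q k <-> r k) -> P r -> P q.
  move=> rr qr kqr Pr; apply: (Pdet r) => // a [<-|/qr]; tauto.
split=> [[[qk [r [rr rk qr Pr]]]|[qk [r [rr rk qr Pr]]]]|Pq].
- by apply: (Pqr r).
- by apply: (Pqr r).
- by case: (EM (q k)) => qk; [left|right]; split=> //; exists q.
Qed.

Fixpoint atoms (s : seq M) : seq M :=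
  if s is x :: s' then map (mmeet x) (atoms s') ++ map (mmeet (mneg x)) (atoms s')
  else [:: mtop M].

Lemma atoms_cover (s : seq M) (q : M -> Prop) : mprime q ->
  exists2 a, List.In a (atoms s) & q a.
Proof.
move=> qq; elim: s => [|x s [a ha qa]] /=.
  by exists (mtop M); [left|rewrite (mprimeE B qq)].
case: (EM (q x)) => qx; [exists (mmeet x a)|exists (mmeet (mneg x) a)];
  rewrite ?(mprimeE B qq) //; apply: List.in_or_app; [left|right];
  exact: List.in_map.
Qed.

Lemma atoms_agree (s : seq M) (a : M) (q q' : M -> Prop) :
  List.In a (atoms s) -> mprime q -> mprime q' -> q a -> q' a -> agree s q q'.
Proof.
move=> + qq qq'; elim: s a => [|x s IH] a /= ha qa qa'; first by move=> y [].
have step b : List.In b (atoms s) -> (q x <-> q' x) -> q b -> q' b ->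
    agree (x :: s) q q'.
  by move=> hb qx qb qb' y [<-//|hy]; exact: IH hb qb qb' y hy.
case: (List.in_app_or _ _ _ ha) => /List.in_map_iff [b [eb hb]]; move: qa qa';
  rewrite -eb !(mprimeE B qq, mprimeE B qq') => -[qx qb] [qx' qb'];
  by apply: (step b).
Qed.

(** * The map on prime filters and the approximation it induces *)

Section Retraction.
Variable s : seq M.

(* The choice depends only on the boxed elements of [s] in [q], so that
   [canonical_point] takes finitely many values. *)
Definition canonical_point (q : M -> Prop) : M -> Prop :=
  let C p := mprime p /\ agree (map (@mbox M) s) q p in
  if pselect (exists p, C p) is left e then proj1_sig (cid e) else q.

Lemma canonical_pointP (q : M -> Prop) : mprime q ->
  mprime (canonical_point q) /\ agree (map (@mbox M) s) q (canonical_point q).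
Proof.
move=> qq; rewrite /canonical_point; case: pselect => [e|[]]; first by case: cid.
by exists q.
Qed.

Lemma canonical_point_eq (q q' : M -> Prop) : mprime q ->
  agree (map (@mbox M) s) q q' -> canonical_point q = canonical_point q'.
Proof.
move=> qq ag; rewrite /canonical_point.
have -> : (fun p => mprime p /\ agree (map (@mbox M) s) q p) =
    (fun p => mprime p /\ agree (map (@mbox M) s) q' p).
  apply: funext => p; apply: propext.
  by split=> -[pp qp]; split=> // a ha; have := ag a ha; have := qp a ha; tauto.
by case: pselect => // -[]; exists q; split=> // a ha; have := ag a ha; tauto.
Qed.

Definition retract (q : M -> Prop) : M -> Prop :=
  if pselect (exists2 a, List.In a (atoms s) & q (kernel a)) is left _ then q
  else canonical_point q.

Lemma retract_prime q : mprime q -> mprime (retract q).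
Proof.
by move=> qq; rewrite /retract; case: pselect => // _; case: (canonical_pointP qq).
Qed.

Lemma retract_box q : mprime q -> agree (map (@mbox M) s) q (retract q).
Proof.
by move=> qq; rewrite /retract; case: pselect => // _; case: (canonical_pointP qq).
Qed.

Lemma retract_kernel q a : List.In a (atoms s) -> q (kernel a) -> retract q = q.
Proof. by move=> ha qa; rewrite /retract; case: pselect => // -[]; exists a. Qed.

(** Points in the kernel of the same atom are fixed and agree on [s]; points outside all kernels
    have the same canonical point if their boxed elements agree. *)
Lemma retract_agree q q' : mprime q -> mprime q' ->
  agree (map (@kernel M) (atoms s) ++ map (@mbox M) s) q q' ->
  agree s (retract q) (retract q').
Proof.
move=> qq qq' ag.
have agk a : List.In a (atoms s) -> q (kernel a) <-> q' (kernel a).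
  by move=> ha; apply/ag/List.in_or_app; left; exact: List.in_map.
case: (EM (exists2 a, List.In a (atoms s) & q (kernel a))) => [[a ha qa]|noa].
  have qa' := (agk a ha).1 qa.
  rewrite (retract_kernel ha qa) (retract_kernel ha qa').
  move: qa qa'; rewrite !(mprimeE B qq, mprimeE B qq') => -[qa _] [qa' _].
  exact: (atoms_agree ha).
have noa' : ~ exists2 a, List.In a (atoms s) & q' (kernel a).
  by move=> [a ha /(agk a ha) qa]; apply: noa; exists a.
rewrite /retract; case: pselect => // _; case: pselect => // _.
rewrite (canonical_point_eq (q' := q')) // => a ha.
by apply/ag/List.in_or_app; right.
Qed.

Definition is_approximation (phi : M -> M) : Prop :=
  forall a, List.In a s -> forall q, mprime q -> q (phi a) <-> retract q a.

Lemma approximation_exists :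
  exists2 phi, is_approximation phi & forall a, gen (phi a).
Proof.
have ex (a : M) : exists c, gen c /\
    (List.In a s -> forall q, mprime q -> q c <-> retract q a).
  (* Elements outside [s] get the dummy value [mbot M]. *)
  case: (EM (List.In a s)) => ha; last by exists (mbot M); split=> //; exact: gen_bot.
  have [||c gc cP] := @gen_determined (map (@kernel M) (atoms s) ++ map (@mbox M) s)
      (fun q => retract q a); last by exists c; split.
  - move=> b hb; case: (List.in_app_or _ _ _ hb) => /List.in_map_iff [d [<- _]].
      exact: gen_kernel.
    exact: gen_box.
  - by move=> q q' qq qq' ag; exact: (retract_agree qq qq' ag ha).1.
have [phi phiP] := choice ex.
by exists phi => a; case: (phiP a).
Qed.

Hypothesis hg : is_grzegorczyk_algebra M.
Variables (phi : M -> M) (phiP : is_approximation phi).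

(** A point [p] lies in some atom [c]. The kernel of [c] contains a fixed point [q], which agrees
    with [p] on [s], and there [phi] changes nothing. *)
Lemma approximation_inj a b :
  List.In a s -> List.In b s -> phi a = phi b -> a = b.
Proof.
move=> ha hb eab; apply: (mprime_ext B) => p pp.
have [c hc pc] := atoms_cover s pp.
(* If no point were in the kernel of [c], its negation would have box [1], against cofinality at
   [p]. *)
have : ~ mle (mbox (mneg (mbot M))) (mbox (mneg (kernel c))) -> 
  exists2 q, mprime q & q (kernel c).
  move=> nle; apply: contrapT => no; apply: nle; apply: mbox_mono => //.
  apply/(mprime_leP B) => r rr _; rewrite (mprimeE B rr) => rc.
  by apply: no; exists r.
case=> [/(mprime_leP B) le|q qq qc].
  apply: (grzegorczyk_cofinal hM hg pp pc); apply: le => //.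
  have -> : mneg (mbot M) = mtop M.
    by apply: (mprime_ext B) => r rr; rewrite !(mprimeE B rr); tauto.
  by rewrite (ma_box1 (ia_modal hM)) (mprimeE B pp).
have := phiP ha qq; have := phiP hb qq; rewrite eab (retract_kernel hc qc).
move: qc; rewrite (mprimeE B qq) => -[qc _].
by have := atoms_agree hc pp qq pc qc ha; have := atoms_agree hc pp qq pc qc hb; tauto.
Qed.

(* [phi a] is disjoint from the kernels of the atoms below [mneg a], and the
   kernel of an atom is cofinal in it. *)
Lemma approximation_box a : List.In a s -> List.In (mbox a) s ->
  phi (mbox a) = mbox (phi a).
Proof.
move=> ha hba.
(* [retract] preserves the boxed elements of [s]. *)
have -> : phi (mbox a) = mbox a.
  apply: (mprime_ext B) => q qq; rewrite (phiP hba qq).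
  by have := retract_box qq (List.in_map (@mbox M) _ _ ha); tauto.
apply: (mprime_ext B) => q qq; split.
  rewrite -{1}(ia_box_box hM); apply: (box_mono_prime hM) => // r rr ra.
  apply/(phiP ha rr); apply: (prime_box hM (retract_prime rr)).
  by apply/(retract_box rr _).1: ra; exact: List.in_map.
rewrite -{1}(ia_box_box hM); apply: (box_mono_prime hM) => // r rr ra.
apply: contrapT => nra; have [c hc rc] := atoms_cover s rr.
apply: (grzegorczyk_cofinal hM hg rr rc).
apply: (box_mono_prime hM) ra => // p pp pa; rewrite (mprimeE B pp) => pc.
have := phiP ha pp; rewrite (retract_kernel hc pc).
move: pc; rewrite (mprimeE B pp) => -[pc _].
by have := atoms_agree hc rr pp rc pc ha; tauto.
Qed.

Lemma approximation_partial_hom : partial_hom s phi.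
Proof.
case=> /= x hx ix.
- rewrite [x]args2_eta in ix *; rewrite args2_comp; apply: (mprime_ext B) => q qq.
  apply: iff_trans (phiP ix qq) _; rewrite [X in _ <-> X](mprime_meet qq).
  rewrite (mprime_meet (retract_prime qq)).
  by have := phiP (hx ord0) qq; have := phiP (hx ord_max) qq; tauto.
- rewrite [x]args2_eta in ix *; rewrite args2_comp; apply: (mprime_ext B) => q qq.
  apply: iff_trans (phiP ix qq) _; rewrite [X in _ <-> X](mprime_join qq).
  rewrite (mprime_join (retract_prime qq)).
  by have := phiP (hx ord0) qq; have := phiP (hx ord_max) qq; tauto.
- rewrite [x]args1_eta in ix *; rewrite [RHS]/(mneg (phi (x ord0))).
  apply: (mprime_ext B) => q qq.
  apply: iff_trans (phiP ix qq) _; rewrite [X in _ <-> X](mprime_neg B qq).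
  rewrite (mprime_neg B (retract_prime qq)).
  by have := phiP (hx ord0) qq; tauto.
- by rewrite [x]args1_eta in ix *; exact: approximation_box.
- rewrite [x]args0_eta in ix *; rewrite args0_comp; apply: (mprime_ext B) => q qq.
  apply: iff_trans (phiP ix qq) _; rewrite [X in _ <-> X](mprime_bot qq).
  by rewrite (mprime_bot (retract_prime qq)).
- rewrite [x]args0_eta in ix *; rewrite args0_comp; apply: (mprime_ext B) => q qq.
  apply: iff_trans (phiP ix qq) _; rewrite [X in _ <-> X](mprime_top qq).
  by rewrite (mprime_top (retract_prime qq)).
Qed.
End Retraction.

(** On the list of subterm values, [phi] is an injective partial homomorphism. *)
Lemma generated_env (v : du_sentence modal_sig) (env : nat -> M) :
  is_grzegorczyk_algebra M ->
  exists2 env' : nat -> M, forall n, gen (env' n) &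
    forall e, List.In e (equations v) -> eq_holds env e <-> eq_holds env' e.
Proof.
move=> hg; have [s sP] := covers_equations env (equations v).
have [phi phiP gphi] := approximation_exists s.
exists (fun n => phi (env n)) => // e /sP [c1 c2].
have hphi := approximation_partial_hom hg phiP.
rewrite /eq_holds -!(partial_hom_eval hphi) //; split=> [->//|].
by apply: (approximation_inj hg phiP); exact: covers_eval.
Qed.
End Approximation.

(** * The Goedel translation *)

(** Applied to modal terms it yields the translation, applied to [M] its meaning; the open elements
    of [M] embed in it as a subalgebra. *)
Definition godel_algebra (M : algebra modal_sig) : algebra heyting_sig :=
  @Algebra heyting_sig M (fun o =>
    match o return ('I_(heyting_arity o) -> M) -> M with
    | HMeet => fun x => mmeet (x ord0) (x ord_max)
    | HJoin => fun x => mjoin (x ord0) (x ord_max)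
    | HImp => fun x => mbox (mimp (x ord0) (x ord_max))
    | HBot => fun=> mbot M
    | HTop => fun=> mtop M
    end).

Definition godel (t : term heyting_sig) : term modal_sig :=
  eval (A := godel_algebra (term_algebra modal_sig))
    (fun n => mbox (Var modal_sig n : term_algebra modal_sig)) t.

Definition godel_du : du_sentence heyting_sig -> du_sentence modal_sig :=
  map_du (fun e => (godel e.1, godel e.2)).

Lemma godel_algebra_hom (M N : algebra modal_sig) (f : M -> N) :
  is_hom f -> is_hom (f : godel_algebra M -> godel_algebra N).
Proof.
move=> hf; apply: heyting_homP => [a b|a b|a b||].
- exact: (hom_mmeet hf).
- exact: (hom_mjoin hf).
- exact: etrans (hom_mbox hf _) (congr1 _ (hom_mimp hf _ _)).
- exact: (hom_mbot hf).
- exact: (hom_mtop hf).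
Qed.

Section Godel.
Variables (M : algebra modal_sig) (hM : is_interior_algebra M).

Lemma opens_godel_hom :
  is_hom (fun a : opens hM => proj1_sig a : godel_algebra M).
Proof. by case. Qed.

Lemma eval_godel (env : nat -> M) (env' : nat -> opens hM) (t : term heyting_sig) :
  (forall n, mbox (env n) = proj1_sig (env' n)) ->
  eval env (godel t) = proj1_sig (eval env' t).
Proof.
move=> envE; rewrite (eval_hom _ _ opens_godel_hom).
rewrite (eval_hom _ _ (godel_algebra_hom (@eval_is_hom _ M env))).
congr (@eval _ (godel_algebra M) _ t); apply: funext => n.
by rewrite -envE (hom_mbox (@eval_is_hom _ M env)).
Qed.

Lemma eq_holds_godel (env : nat -> M) (env' : nat -> opens hM)
    (e : equation heyting_sig) :
  (forall n, mbox (env n) = proj1_sig (env' n)) ->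
  eq_holds env' e <-> eq_holds env (godel e.1, godel e.2).
Proof.
move=> envE; rewrite /eq_holds /= !(eval_godel _ envE).
by split=> [->//|]; exact: open_elt_inj.
Qed.

Lemma satisfies_godel (v : du_sentence heyting_sig) :
  satisfies M (godel_du v) <-> satisfies (opens hM) v.
Proof.
split; [apply: map_du_satisfies => env'|apply: satisfies_map_du => env].
  by exists (fun n => proj1_sig (env' n)) => e;
    apply: eq_holds_godel => n; exact: proj2_sig (env' n).
exists (fun n => exist _ _ (open_box hM (env n))) => e.
exact: eq_holds_godel.
Qed.
End Godel.

(** * Translating modal sentences *)

Local Notation nf_term := (nf_algebra (term_algebra heyting_sig)).

Local Notation evaluation env := (eval env : term_algebra heyting_sig -> _).

(** [theta] gives each modal variable a normal form over Heyting terms. Both sides become such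
    normal forms, and their equality becomes [[](l <-> l') = 1]. *)
Definition nf_equation (theta : nat -> nf_term) (e : equation modal_sig) :
    equation heyting_sig :=
  let l := eval theta e.1 in let l' := eval theta e.2 in
  (nf_core (mmeet (mimp l l') (mimp l' l)), htop (term_algebra heyting_sig)).

Definition nf_du (theta : nat -> nf_term) :
  du_sentence modal_sig -> du_sentence heyting_sig := map_du (nf_equation theta).

Section NormalFormTranslation.
Variables (M : algebra modal_sig) (hM : is_interior_algebra M).

Lemma eq_holds_nf (env : nat -> opens hM) (theta : nat -> nf_term)
    (e : equation modal_sig) :
  eq_holds (fun n => den (evaluation env) (theta n)) e <->
  eq_holds env (nf_equation theta e).
Proof.
have hev := @eval_is_hom _ (opens hM) env.
rewrite /eq_holds -!(eval_hom _ _ (den_hom hev)) -(box_iffE hev).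
rewrite [eval env (nf_equation theta e).2](hom_htop hev).
by split=> [?|->//]; exact: open_elt_inj.
Qed.

Lemma generated_env_nf (env : nat -> M) :
  (forall n, generated_by_opens hM (env n)) ->
  exists (theta : nat -> nf_term) (env' : nat -> opens hM),
    env = fun n => den (evaluation env') (theta n).
Proof.
move=> /choice [l lE].
(* One Heyting variable for each modal variable [n], clause index [j] and side [b] of the clause. *)
pose var (n j : nat) (b : bool) : term_algebra heyting_sig :=
  Var heyting_sig (pickle (n, j, b)).
exists (fun n => mkseq (fun j => (var n j false, var n j true)) (size (l n))).
pose one := htop (opens hM).
(* Codes of no clause entry receive the dummy value [one]. *)
exists (fun k => if unpickle k is Some (n, j, b) then
  let c := nth (one, one) (l n) j in if (b : bool) then c.2 else c.1 else one).
apply: funext => n; rewrite -lE -{1}(mkseq_nth (one, one) (l n)) /mkseq.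
by elim: (iota _ _) => //= j s ->; rewrite !pickleK.
Qed.

(** Each [theta] with an open assignment denotes an assignment in [M]; conversely [generated_env]
    reduces any assignment to one of this kind. Clause numbers are unbounded, hence the family over
    all [theta]. *)
Lemma satisfies_nf (v : du_sentence modal_sig) : is_grzegorczyk_algebra M ->
  satisfies M v <-> forall theta, satisfies (opens hM) (nf_du theta v).
Proof.
move=> hg; split=> [Mv theta|Ov].
  apply: satisfies_map_du Mv => env.
  by exists (fun n => den (evaluation env) (theta n)) => e; exact: eq_holds_nf.
rewrite -satisfies_map_id => env.
have [env1 /generated_env_nf [theta [env2 ->]] env1E] := generated_env hM v env hg.
apply: (map_du_env (A := M) (B := M) (g := id) _).1 => [e ev|].
  exact: iff_sym (env1E e ev).
by apply: (map_du_env (fun e _ => eq_holds_nf env2 theta e)).2; exact: Ov.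
Qed.
End NormalFormTranslation.

(** * The class sigma(U) *)

Section GrzegorczykUniversal.

Let evE (N : algebra modal_sig) (env : nat -> N) :=
  let h := @eval_is_hom _ N env in
  (hom_mmeet h, hom_mjoin h, hom_mneg h, hom_mbox h, hom_mbot h, hom_mtop h).

Let x : term_algebra modal_sig := Var modal_sig 0.
Let y : term_algebra modal_sig := Var modal_sig 1.
Let z : term_algebra modal_sig := Var modal_sig 2.

(** Take as axioms all sentences valid in Grzegorczyk algebras; the defining laws are among them, as
    identities in at most three variables. *)
Lemma grzegorczyk_universal : universal_class is_grzegorczyk_algebra.
Proof.
exists (fun v => forall N, is_grzegorczyk_algebra N -> satisfies N v) => M.
split=> [hM v hv|Mv]; first exact: hv.
have law (s t : term_algebra modal_sig) (a b c : M) :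
    (forall (N : algebra modal_sig), is_grzegorczyk_algebra N ->
      forall env : nat -> N, eval env s = eval env t) ->
    eval (nth a [:: a; b; c]) s = eval (nth a [:: a; b; c]) t.
  set env := nth _ _ => st; have ne : ~ (@size (equation modal_sig) [::] = 0 /\
    size [:: (s, t)] = 0) by case.
  have sat : satisfies M (DUSentence ne).
    by apply: Mv => N hN env' _; left; exact: st.
  by case/List.Exists_cons: (sat env (List.Forall_nil _)) => // /List.Exists_nil.
Ltac by_law s t a b c := have := @law s t a b c; rewrite !evE; apply;
  move=> N [[[[L D nN jN] bI b1] bb bl] grz] env; rewrite !evE.
split; first split; first split; first split; first split.
- by move=> a b; by_law (mmeet x y) (mmeet y x) a b a; exact: (bl_meetC L).
- by move=> a b; by_law (mjoin x y) (mjoin y x) a b a; exact: (bl_joinC L).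
- move=> a b c; by_law (mmeet x (mmeet y z)) (mmeet (mmeet x y) z) a b c.
  exact: (bl_meetA L).
- move=> a b c; by_law (mjoin x (mjoin y z)) (mjoin (mjoin x y) z) a b c.
  exact: (bl_joinA L).
- by move=> a b; by_law (mmeet x (mjoin x y)) x a b a; exact: (bl_meetK L).
- by move=> a b; by_law (mjoin x (mmeet x y)) x a b a; exact: (bl_joinK L).
- by move=> a; by_law (mmeet x (mtop _)) x a a a; exact: (bl_meet1 L).
- by move=> a; by_law (mjoin x (mbot _)) x a a a; exact: (bl_join0 L).
- move=> a b c.
  by_law (mmeet (mjoin x y) z) (mjoin (mmeet x z) (mmeet y z)) a b c; exact: D.
- by move=> a; by_law (mmeet x (mneg x)) (mbot (term_algebra modal_sig)) a a a.
- by move=> a; by_law (mjoin x (mneg x)) (mtop (term_algebra modal_sig)) a a a.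
- move=> a b.
  by_law (mbox (mmeet x y)) (mmeet (mbox x) (mbox y)) a b a; exact: bI.
(* The law has no variables; [mtop M] only fills the assignment. *)
- have := mtop M => a.
  by by_law (mbox (mtop (term_algebra modal_sig)))
    (mtop (term_algebra modal_sig)) a a a.
- by move=> a; by_law (mbox (mbox x)) (mbox x) a a a; exact: bb.
- by move=> a; by_law (mmeet (mbox x) x) (mbox x) a a a; exact: bl.
- move=> a; pose g := mbox (mjoin (mneg (mbox (mjoin (mneg x) (mbox x)))) x).
  by by_law (mmeet g x) g a a a; exact: grz.
Qed.
End GrzegorczykUniversal.

Lemma free_boolean_extension_exists (H : algebra heyting_sig) :
  is_heyting_algebra H ->
  exists (M : algebra modal_sig) (hM : is_interior_algebra M) (i : H -> opens hM),
    is_free_boolean_extension i.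
Proof.
move=> hH; exists (boolean_extension H), (boolean_extension_interior hH).
by exists (ext_inj hH); exact: boolean_extension_free.
Qed.

(** Stated for arbitrary classes, so that it also covers the subclasses cut out by a sentence and
    its translation. *)
Definition corresponds (C : algebra modal_sig -> Prop)
    (K : algebra heyting_sig -> Prop) : Prop :=
  forall M, C M <->
    exists2 hM : is_interior_algebra M, is_grzegorczyk_algebra M & K (opens hM).

Lemma corresponds_godel (C : algebra modal_sig -> Prop)
    (K : algebra heyting_sig -> Prop) (v : du_sentence heyting_sig) :
  corresponds C K ->
  corresponds (fun M => C M /\ satisfies M (godel_du v))
    (fun H => K H /\ satisfies H v).
Proof.
move=> CK M; split=> [[/CK [hM gM KM] Mv]|[hM gM [KM Mv]]].
  by exists hM => //; split=> //; apply/satisfies_godel.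
by split; [apply/CK; exists hM|apply/(satisfies_godel hM)].
Qed.

Lemma corresponds_nf (C : algebra modal_sig -> Prop)
    (K : algebra heyting_sig -> Prop) (v : du_sentence modal_sig) :
  corresponds C K ->
  corresponds (fun M => C M /\ satisfies M v)
    (fun H => K H /\ forall theta, satisfies H (nf_du theta v)).
Proof.
move=> CK M; split=> [[/CK [hM gM KM] Mv]|[hM gM [KM Mv]]].
  by exists hM => //; split=> //; apply/satisfies_nf.
by split; [apply/CK; exists hM|apply/(satisfies_nf hM)].
Qed.

Section HoldsInCorresponding.
Variables (C : algebra modal_sig -> Prop) (K : algebra heyting_sig -> Prop).
Hypothesis CK : corresponds C K.
Hypothesis K_iso :
  forall (A B : algebra heyting_sig) (f : A -> B), is_iso f -> K A -> K B.
Hypothesis K_heyting : forall H, K H -> is_heyting_algebra H.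

Lemma corresponding_exists (H : algebra heyting_sig) : K H ->
  exists (M : algebra modal_sig) (hM : is_interior_algebra M) (i : H -> opens hM),
    [/\ C M, is_grzegorczyk_algebra M & is_iso i].
Proof.
move=> KH; have [M [hM [i fi]]] := free_boolean_extension_exists (K_heyting KH).
have gM := free_boolean_extension_grzegorczyk fi.
exists M, hM, i; split=> //; last exact: fbe_iso fi.
by apply/CK; exists hM => //; apply: K_iso (fbe_iso fi) KH.
Qed.

Lemma holds_in_godel (v : du_sentence heyting_sig) :
  holds_in C (godel_du v) <-> holds_in K v.
Proof.
split=> [Cv H KH|Kv M /CK [hM _ KM]]; last by apply/(satisfies_godel hM)/Kv.
have [M [hM [i [CM _ isoi]]]] := corresponding_exists KH.
exact/(satisfies_iso v isoi)/(satisfies_godel hM)/Cv.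
Qed.

Lemma holds_in_nf (v : du_sentence modal_sig) :
  holds_in C v <-> forall theta, holds_in K (nf_du theta v).
Proof.
split=> [Cv theta H KH|Kv M /CK [hM gM KM]].
  have [M [hM [i [CM gM isoi]]]] := corresponding_exists KH.
  apply/(satisfies_iso _ isoi); apply: (satisfies_nf hM v gM).1; exact: Cv.
by apply/(satisfies_nf hM v gM) => theta; exact: Kv.
Qed.
End HoldsInCorresponding.

(** * Completeness *)

Lemma holds_in_weakly_admissible (S : signature) (K : algebra S -> Prop)
    (v : du_sentence S) : holds_in K v -> weakly_admissible K v.
Proof.
move=> Kv e _; split=> [Ke A [KA _]|Ke A KA]; first exact: Ke.
by apply: Ke; split=> //; exact: Kv.
Qed.

Section Completeness.
Variable U : algebra heyting_sig -> Prop.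
Hypothesis U_universal : universal_class U.
Hypothesis U_heyting : forall H, U H -> is_heyting_algebra H.

Lemma universal_class_iso (A B : algebra heyting_sig) (f : A -> B) :
  is_iso f -> U A -> U B.
Proof.
move=> hf; have [Sg US] := U_universal.
by move=> /US hU; apply/US => v /hU; rewrite (satisfies_iso v hf).
Qed.

(** One inclusion holds because the Goedel translations of the axioms of [U] define a universal
    class of Grzegorczyk algebras containing every B(H). *)
Lemma sigma_corresponds : corresponds (sigma U) U.
Proof.
move=> M; have [Sg US] := U_universal; split=> [sM|[hM gM UM] C [SgC CS] _ freeC].
  pose C (N : algebra modal_sig) :=
    is_grzegorczyk_algebra N /\ forall v, Sg v -> satisfies N (godel_du v).
  suff [gM hM] : C M.
    by exists gM.1 => //; apply/US => v /hM /satisfies_godel; apply.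
  apply: sM => [|N []//|H N UH [hN [i free_i]]].
    have [SgG GS] := grzegorczyk_universal.
    exists (fun v => SgG v \/ exists2 w, Sg w & v = godel_du w) => N.
    split=> [[/GS hN Nv] v [/hN//|[w /Nv hw ->//]]|hN].
    split; first by apply/GS => v hv; apply: hN; left.
    by move=> v hv; apply: hN; right; exists v.
  split; first exact: free_boolean_extension_grzegorczyk free_i.
  move=> v hv; apply/(satisfies_godel hN)/(satisfies_iso v (fbe_iso free_i)).
  exact: (US H).1 UH v hv.
(* [M] and B(O(M)) have isomorphic open elements, so by [satisfies_nf] they satisfy the same
   sentences. *)
have [N [hN [i free_i]]] := free_boolean_extension_exists (U_heyting UM).
have gN := free_boolean_extension_grzegorczyk free_i.
have CN : C N by apply: (freeC _ _ UM); exists hN, i.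
apply/CS => v /((CS N).1 CN v) /(satisfies_nf hN v gN) Nv.
apply/(satisfies_nf hM v gM) => theta.
by apply/(satisfies_iso _ (fbe_iso free_i)).
Qed.

Let sU := sigma_corresponds.

Lemma holds_in_sigma_godel (v : du_sentence heyting_sig) :
  holds_in (sigma U) (godel_du v) <-> holds_in U v.
Proof. exact: (holds_in_godel sU universal_class_iso U_heyting). Qed.

Lemma holds_in_sigma_nf (v : du_sentence modal_sig) :
  holds_in (sigma U) v <-> forall theta, holds_in U (nf_du theta v).
Proof. exact: (holds_in_nf sU universal_class_iso U_heyting). Qed.

(** An identity on [sigma U], or on its subclass given by [godel_du v], amounts to the identities
    [nf_du theta e] on [U], or on its subclass given by [v]. *)
Lemma weakly_admissible_godel (v : du_sentence heyting_sig) :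
  weakly_admissible U v -> weakly_admissible (sigma U) (godel_du v).
Proof.
move=> wv e ide; rewrite holds_in_sigma_nf (holds_in_nf (corresponds_godel v sU)).
- have wve theta := wv _ (map_du_identity (nf_equation theta) ide).
  by split=> he theta; apply/wve; exact: he.
- move=> A B f hf [UA Av]; split; first exact: universal_class_iso hf UA.
  exact/(satisfies_iso v hf).
- by move=> H [/U_heyting].
Qed.

(** Members of [sigma U] satisfying [v] have open elements satisfying all translations of [v], in
    particular the one for [theta]; so Goedel translations of identities valid under that one hold
    there. *)
Lemma weakly_admissible_nf (v : du_sentence modal_sig)
    (theta : nat -> nf_algebra (term_algebra heyting_sig)) :
  weakly_admissible (sigma U) v -> weakly_admissible U (nf_du theta v).
Proof.
move=> wv e ide; split=> [Ue H [UH _]|Ue]; first exact: Ue.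
apply/holds_in_sigma_godel; apply: (wv _ (map_du_identity _ ide)).2.
apply/(holds_in_godel (corresponds_nf v sU)).
- move=> A B f hf [UA Av]; split; first exact: universal_class_iso hf UA.
  by move=> theta'; apply/(satisfies_iso _ hf).
- by move=> H [/U_heyting].
- by move=> H [UH Hv]; apply: Ue.
Qed.
End Completeness.

Theorem theorem5p9 (U : algebra heyting_sig -> Prop)
    (U_universal : universal_class U)
    (U_heyting : forall H, U H -> is_heyting_algebra H) :
  (strongly_structurally_complete U <->
     strongly_structurally_complete (sigma U)) /\
  (strongly_universally_complete U <->
     strongly_universally_complete (sigma U)).
Proof.
have up v := @weakly_admissible_godel U U_universal U_heyting v.
have down v th := @weakly_admissible_nf U U_universal U_heyting v th.
have hup v := @holds_in_sigma_godel U U_universal U_heyting v.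
have hdown v := @holds_in_sigma_nf U U_universal U_heyting v.
split; split=> complete.
(* Every translation of [q] is weakly admissible for [U] and so holds in [U]; jointly the
   translations give [q] in [sigma U]. *)
- move=> q qi; split=> [wq|]; last exact: holds_in_weakly_admissible.
  apply/hdown => theta.
  by apply/complete; [exact: map_du_quasi_identity|exact: down].
- move=> q qi; split=> [/up wq|]; last exact: holds_in_weakly_admissible.
  by apply/hup/complete => //; exact: map_du_quasi_identity.
- move=> v; split=> [wv|]; last exact: holds_in_weakly_admissible.
  by apply/hdown => theta; apply/complete/down.
- move=> v; split=> [/up wv|]; last exact: holds_in_weakly_admissible.
  exact/hup/complete.
Qed.
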